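(* Let $r \geq 1$ be fixed. Given a graph $G$, an integer $b$, and a $k$-expression $\mu$ for $G$, \textsc{Deletion to $r$-Colorable} on $(G,b)$ can be solved in time $\mathcal{O}^*((2^r)^k)$.
   Context: \textsc{Deletion to $r$-Colorable}: given an undirected graph $G=(V,E)$ and an integer $b$, decide whether there is $Y \subseteq V$ with $|Y| \leq b$ such that $G - Y$ has chromatic number at most $r$. A labeled graph is a graph with a label function $\ell: V \to \mathbb{N}$. Clique-expressions are built from: introduce $i(v)$ (single vertex $v$ with label $i$), disjoint union of two labeled graphs, relabel $\rho_{i\to j}$ (change all labels $i$ to $j$), and join $\eta_{i,j}$, $i\ne j$ (add all edges between label-$i$ and label-$j$ vertices). A $k$-expression is a clique-expression in which every intermediate labeled graph uses only labels from $\{1,\dots,k\}$; it is a $k$-expression for $G$ if the constructed graph is isomorphic to $G$ after forgetting labels. $\mathcal{O}^*$ suppresses factors polynomial in the input size. *)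

(* Defs.v *)
From mathcomp Require Import all_boot all_order all_algebra.

Set Implicit Arguments.
Unset Strict Implicit.
Unset Printing Implicit Defensive.

Record sgraph := SGraph {
  vert :> finType;
  edge : rel vert;
  edge_sym : symmetric edge;
  edge_irr : irreflexive edge }.

Definition isomorphic (G H : sgraph) : Prop :=
  exists2 f : G -> H, bijective f & forall u v, edge (f u) (f v) = edge u v.

Definition colorable (G : sgraph) (q : nat) : bool :=
  [exists f : {ffun G -> 'I_q}, forall u, forall v, edge u v ==> (f u != f v)].

Lemma colorable_ex (G : sgraph) : exists q, colorable G q.
Proof.
exists #|G|; apply/existsP; exists [ffun v => enum_rank v].
apply/forallP => u; apply/forallP => v; apply/implyP => uv; rewrite !ffunE.
by apply: contraTneq uv => /enum_rank_inj ->; rewrite edge_irr.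
Qed.

Definition chromatic_number (G : sgraph) : nat := ex_minn (colorable_ex G).

Section DeleteVertices.
Variables (G : sgraph) (Y : {set G}).

Definition del_edge : rel {v : G | v \notin Y} :=
  fun u v => edge (val u) (val v).

Lemma del_edge_sym : symmetric del_edge.
Proof. by move=> u v; apply: edge_sym. Qed.

Lemma del_edge_irr : irreflexive del_edge.
Proof. by move=> u; apply: edge_irr. Qed.

Definition del_vertices : sgraph := SGraph del_edge_sym del_edge_irr.
End DeleteVertices.

Definition deletion_to_colorable (r : nat) (G : sgraph) (b : int) : Prop :=
  exists Y : {set G},
    (#|Y|%:Z <= b)%R /\ chromatic_number (del_vertices Y) <= r.

Record lgraph := LGraph {
  lg_graph :> sgraph;
  label : lg_graph -> nat }.

Lemma unit_edge_sym : symmetric (fun _ _ : unit => false).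
Proof. by []. Qed.

Lemma unit_edge_irr : irreflexive (fun _ _ : unit => false).
Proof. by []. Qed.

Definition lg_introduce (i : nat) : lgraph :=
  @LGraph (SGraph unit_edge_sym unit_edge_irr) (fun _ => i).

Section Union.
Variables A B : lgraph.

Definition union_edge : rel (A + B)%type := fun x y =>
  match x, y with
  | inl u, inl v => edge u v
  | inr u, inr v => edge u v
  | _, _ => false
  end.

Lemma union_edge_sym : symmetric union_edge.
Proof. by move=> [u|u] [v|v] //=; apply: edge_sym. Qed.

Lemma union_edge_irr : irreflexive union_edge.
Proof. by move=> [u|u] /=; apply: edge_irr. Qed.

Definition lg_union : lgraph :=
  @LGraph (SGraph union_edge_sym union_edge_irr)
    (fun x => match x with inl u => label u | inr u => label u end).
End Union.

Definition lg_relabel (i j : nat) (A : lgraph) : lgraph :=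
  @LGraph A (fun v => if label v == i then j else label v).

Section Join.
Variables (i j : nat) (ij : i != j) (A : lgraph).

Definition join_edge : rel A := fun u v =>
  [|| edge u v, (label u == i) && (label v == j)
    | (label u == j) && (label v == i)].

Lemma join_edge_sym : symmetric join_edge.
Proof.
move=> u v; rewrite /join_edge edge_sym; congr (_ || _).
by rewrite orbC; congr (_ || _); apply: andbC.
Qed.

Lemma join_edge_irr : irreflexive join_edge.
Proof.
move=> u; rewrite /join_edge edge_irr /=.
by case: eqP => [->|_]; rewrite ?andbF // (negbTE ij).
Qed.

Definition lg_join : lgraph :=
  @LGraph (SGraph join_edge_sym join_edge_irr) (@label A).
End Join.

(* The name v in the operation i(v) is not recorded: expressions are only
   considered up to isomorphism of the graph they construct, and [lg_union]
   makes the two vertex sets disjoint. *)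
Inductive cexpr : Type :=
| Introduce (i : nat)
| Union (mu nu : cexpr)
| Relabel (i j : nat) (mu : cexpr)
| Join (i j : nat) (ij : i != j) (mu : cexpr).

Fixpoint eval (mu : cexpr) : lgraph :=
  match mu with
  | Introduce i => lg_introduce i
  | Union mu1 mu2 => lg_union (eval mu1) (eval mu2)
  | Relabel i j mu1 => lg_relabel i j (eval mu1)
  | Join i j ij mu1 => lg_join ij (eval mu1)
  end.

Definition labels_in (k : nat) (A : lgraph) : Prop :=
  forall v : A, 1 <= label v <= k.

Fixpoint k_expression (k : nat) (mu : cexpr) : Prop :=
  labels_in k (eval mu) /\
  match mu with
  | Introduce _ => True
  | Union mu1 mu2 => k_expression k mu1 /\ k_expression k mu2
  | Relabel _ _ mu1 | Join _ _ _ mu1 => k_expression k mu1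
  end.

Definition k_expression_for (k : nat) (mu : cexpr) (G : sgraph) : Prop :=
  k_expression k mu /\ isomorphic (eval mu) G.

(* The random access machine of Aho, Hopcroft and Ullman, with while loops in
   place of jumps: cells indexed by nat and holding natural numbers, literal,
   direct and indirect operands, and a sequential input tape of natural
   numbers, which reads as 0 once it is exhausted. *)

Inductive address : Type :=
| Direct (a : nat)
| Indirect (a : nat).

Inductive operand : Type :=
| Lit (n : nat)
| Cell (x : address).

Inductive binop : Type := Add | Sub | Mul | Div.

Inductive program : Type :=
| Skip
| Read (x : address)
| Assign (x : address) (op : binop) (p q : operand)
| Seq (P Q : program)
| IfNonzero (p : operand) (P Q : program)
| WhileNonzero (p : operand) (P : program).

Record state := State { mem : nat -> nat; tape : seq nat }.

Definition locate (M : nat -> nat) (x : address) : nat :=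
  match x with Direct a => a | Indirect a => M a end.

Definition value (M : nat -> nat) (p : operand) : nat :=
  match p with Lit n => n | Cell x => M (locate M x) end.

(* Sub is truncated, and division by 0 yields 0. *)
Definition apply_binop (op : binop) (m n : nat) : nat :=
  match op with
  | Add => m + n
  | Sub => m - n
  | Mul => m * n
  | Div => m %/ n
  end.

Definition write (M : nat -> nat) (a n : nat) : nat -> nat :=
  fun c => if c == a then n else M c.

(* Number of binary digits, with bitlen 0 = 1. *)
Definition bitlen (n : nat) : nat := (trunc_log 2 n).+1.

Definition address_cost (M : nat -> nat) (x : address) : nat :=
  match x with
  | Direct a => bitlen a
  | Indirect a => bitlen a + bitlen (M a)
  end.

Definition operand_cost (M : nat -> nat) (p : operand) : nat :=
  match p with
  | Lit n => bitlen n
  | Cell x => address_cost M x + bitlen (value M p)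
  end.

(* [exec P s s' t]: from s, the program P halts in s' at total cost t. *)
Inductive exec : program -> state -> state -> nat -> Prop :=
| ExecSkip s : exec Skip s s 1
| ExecRead x M w :
    exec (Read x) (State M w)
      (State (write M (locate M x) (head 0 w)) (behead w))
      (1 + address_cost M x + bitlen (head 0 w))
| ExecAssign x op p q M w :
    exec (Assign x op p q) (State M w)
      (State (write M (locate M x) (apply_binop op (value M p) (value M q))) w)
      (1 + address_cost M x + operand_cost M p + operand_cost M q)
| ExecSeq P Q s1 s2 s3 t1 t2 :
    exec P s1 s2 t1 -> exec Q s2 s3 t2 -> exec (Seq P Q) s1 s3 (t1 + t2)
| ExecIfTrue p P Q s s' t :
    value (mem s) p != 0 -> exec P s s' t ->
    exec (IfNonzero p P Q) s s' (1 + operand_cost (mem s) p + t)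
| ExecIfFalse p P Q s s' t :
    value (mem s) p = 0 -> exec Q s s' t ->
    exec (IfNonzero p P Q) s s' (1 + operand_cost (mem s) p + t)
| ExecWhileTrue p P s1 s2 s3 t1 t2 :
    value (mem s1) p != 0 -> exec P s1 s2 t1 ->
    exec (WhileNonzero p P) s2 s3 t2 ->
    exec (WhileNonzero p P) s1 s3 (1 + operand_cost (mem s1) p + t1 + t2)
| ExecWhileFalse p P s :
    value (mem s) p = 0 ->
    exec (WhileNonzero p P) s s (1 + operand_cost (mem s) p).

Definition initial (w : seq nat) : state := State (fun _ => 0) w.

Definition accepting (s : state) : Prop := mem s 0 != 0.

Definition encode_graph (G : sgraph) : seq nat :=
  #|G| :: [seq nat_of_bool (edge u v) | u <- enum G, v <- enum G].

Definition encode_int (b : int) : seq nat :=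
  [:: nat_of_bool (b < 0)%R; `|b|%N].

(* Postfix notation. *)
Fixpoint encode_cexpr (mu : cexpr) : seq nat :=
  match mu with
  | Introduce i => [:: 1; i]
  | Union mu1 mu2 => encode_cexpr mu1 ++ encode_cexpr mu2 ++ [:: 2]
  | Relabel i j mu1 => encode_cexpr mu1 ++ [:: 3; i; j]
  | Join i j _ mu1 => encode_cexpr mu1 ++ [:: 4; i; j]
  end.

Definition encode_instance (G : sgraph) (b : int) (mu : cexpr) : seq nat :=
  encode_graph G ++ encode_int b ++ encode_cexpr mu.

Definition input_size (w : seq nat) : nat := \sum_(n <- w) bitlen n.

(* Main.v *)
(* Dynamic programming over the k-expression. For a labeled graph and a set f(l)
   of allowed colors for every label l, let T(f) be the least number of vertices
   to delete so that the rest has a proper coloring in which label-l vertices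
   take colors in f(l). Since f only bounds the colors from above, a disjoint
   union adds tables entrywise, relabeling i to j replaces f(i) by f(j), and a
   join is a minimum over the ways of making f(i) and f(j) disjoint, which is
   done one color at a time. Each operation thus takes linear time in the table.

   Two points keep the bit cost within the bound. Labels may be exponentially
   large in the input size, so table positions are allotted to labels in order
   of appearance, and there are at most as many as input numbers. Moreover
   [Relabel i j] with no vertex labeled i may mention a j above k, which must not
   enlarge the table: the presence of i is read off the table by comparing the
   entry allowing nothing with the entry allowing one color for label i. *)

From Stdlib Require Import FunctionalExtensionality.
Require Import Defs.
From mathcomp Require Import all_boot all_order all_algebra.
From mathcomp Require Import zify.

Set Implicit Arguments.
Unset Strict Implicit.
Unset Printing Implicit Defensive.

(** * Partial colorings and their cost *)

(** All graphs on the stack share one array. Its rows are bit masks with [r] bits per known label,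
    its columns are stack positions. There are [n] columns, which suffice because the graphs on the
    stack are disjoint and nonempty and have at most [n] vertices together. Row-major order lets a
    new label append rows without moving an entry. The array of label positions is addressed by the
    labels themselves: memory starts at 0, the mark of an unknown label, and a large address costs
    only its bit length. Neither array has a length known in advance, so the two are interleaved.

    Tables are updated in place, which shapes the recurrences: a join consults only smaller masks,
    and a relabeling consults entries that its own update leaves unchanged.

    Bit cost is separated from the counting of steps by one number [W] that bounds all addresses and
    values. Its length must be linear in the input size although [k] can be arbitrarily large, so
    the number of rows is bounded twice, through [k] for the running time and through the input size
    for [W]. *)

Section PartialColorings.
Variables (r : nat) (V : finType).
Implicit Types (E : nat -> rel V) (a : V -> nat -> bool).
Implicit Types (g : {ffun V -> option 'I_r}).

(** The relation takes a color as argument because a join is imposed on one color after another: in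
    between, its edges bind for some colors only. [None] stands for a deleted vertex. *)
Definition partial_coloring E a g : bool :=
  [forall u, forall c : 'I_r, (g u == Some c) ==>
     (a u c && [forall v, E c u v ==> (g v != Some c)])].

Definition num_deleted g : nat := #|[set u | g u == None]|.

Definition min_deletions E a : nat :=
  num_deleted [arg min_(g < [ffun=> None] | partial_coloring E a g) num_deleted g].

Lemma partial_coloringP E a g :
  reflect (forall u (c : 'I_r), g u = Some c ->
             a u c /\ forall v, E c u v -> g v <> Some c)
          (partial_coloring E a g).
Proof.
apply: (iffP forallP) => [H u c gu|H u].
  have := forallP (H u) c; rewrite gu eqxx /= => /andP[-> /forallP Hv].
  by split=> // v Euv; apply/eqP; exact: (implyP (Hv v)).
apply/forallP => c; apply/implyP => /eqP /H [-> Hv] /=.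
by apply/forallP => v; apply/implyP => /Hv/eqP.
Qed.

Lemma partial_coloring_none E a : partial_coloring E a [ffun=> None].
Proof. by apply/partial_coloringP => u c; rewrite ffunE. Qed.

Lemma min_deletionsP E a m :
  reflect (exists2 g, partial_coloring E a g & num_deleted g <= m)
          (min_deletions E a <= m).
Proof.
rewrite /min_deletions.
case: arg_minnP => [|g gP gmin]; first exact: partial_coloring_none.
by apply: (iffP idP) => [gm|[h /gmin gh]]; [exists g|apply: leq_trans].
Qed.

Lemma min_deletions_le_card E a : min_deletions E a <= #|V|.
Proof.
apply/min_deletionsP; exists [ffun=> None]; last exact: max_card.
exact: partial_coloring_none.
Qed.

Lemma min_deletions_le E E' a a' :
  (forall g, partial_coloring E a g -> partial_coloring E' a' g) ->
  min_deletions E' a' <= min_deletions E a.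
Proof.
move=> sub; have /min_deletionsP[g gP gm] := leqnn (min_deletions E a).
by apply/min_deletionsP; exists g => //; apply: sub.
Qed.

Lemma eq_min_deletions E E' a a' :
  (forall g, partial_coloring E a g <-> partial_coloring E' a' g) ->
  min_deletions E a = min_deletions E' a'.
Proof.
move=> eqP_; apply/eqP; rewrite eqn_leq.
by apply/andP; split; apply: min_deletions_le => g /eqP_.
Qed.

Lemma eq_allowed E a a' : (forall u c, c < r -> a u c = a' u c) ->
  min_deletions E a = min_deletions E a'.
Proof.
move=> aa'; apply: eq_min_deletions => g.
by split=> /partial_coloringP gP; apply/partial_coloringP => u c gu;
  have [au Eu] := gP u c gu; rewrite ?aa' // -?aa'.
Qed.

Lemma min_deletions_none E a :
  (forall u c, c < r -> ~~ a u c) -> min_deletions E a = #|V|.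
Proof.
move=> a0; apply/eqP; rewrite eqn_leq min_deletions_le_card /=.
have /min_deletionsP[g /partial_coloringP gP gm] := leqnn (min_deletions E a).
apply: leq_trans gm; rewrite -cardsT; apply: subset_leq_card.
apply/subsetP => u _; rewrite inE; case gu: (g u) => [c|//].
by have [] := gP u c gu; rewrite (negbTE (a0 u c (ltn_ord c))).
Qed.

(** Keeping [u] alone is a partial coloring, unless a loop at [u] forbids it. *)
Lemma min_deletions_some E a u c : c < r -> a u c -> ~~ E c u u ->
  min_deletions E a < #|V|.
Proof.
move=> cr auc Euu; pose g := [ffun v => if v == u then Some (Ordinal cr) else None].
have gP : partial_coloring E a g.
  apply/partial_coloringP => v c'; rewrite ffunE; case: eqP => // -> [<-].
  split=> // w Euw; rewrite ffunE; case: eqP => // wu.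
  by rewrite wu (negbTE Euu) in Euw.
apply: leq_ltn_trans (_ : num_deleted g < _).
  by apply/min_deletionsP; exists g.
rewrite -cardsT; apply: proper_card; apply/properP; split; first exact: subsetT.
by exists u; rewrite ?inE // ffunE eqxx.
Qed.

End PartialColorings.

(** * Costs of labeled graphs under the four operations *)

Section ExpressionCost.
Variable r : nat.
Implicit Types (A B : lgraph) (f : nat -> nat -> bool).

Definition label_cost A (E : nat -> rel A) f : nat :=
  min_deletions r E (fun u c => f (label u) c).

Definition lcost A f : nat := label_cost (fun=> @edge A) f.

Lemma eq_lcost A f f' :
  (forall (u : A) c, c < r -> f (label u) c = f' (label u) c) ->
  lcost A f = lcost A f'.
Proof. by move=> ff'; apply: eq_allowed => u c /ff'. Qed.

Lemma lcost_le A f : lcost A f <= #|A|.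
Proof. exact: min_deletions_le_card. Qed.

Lemma lcost_none A f : (forall (u : A) c, c < r -> ~~ f (label u) c) ->
  lcost A f = #|A|.
Proof. exact: min_deletions_none. Qed.

Lemma lcost_some A f (u : A) c :
  c < r -> f (label u) c -> lcost A f < #|A|.
Proof. by move=> cr fu; apply: (min_deletions_some cr fu); rewrite edge_irr. Qed.

Lemma lcost_introduce i f :
  lcost (lg_introduce i) f = ~~ [exists c : 'I_r, f i c].
Proof.
have card1 : #|lg_introduce i| = 1 := card_unit.
case: existsP => [[c fc]|nf] /=.
  have := @lcost_some (lg_introduce i) f tt c (ltn_ord c) fc.
  by rewrite card1 ltnS leqn0 => /eqP.
transitivity #|lg_introduce i|; last by rewrite card1.
apply: lcost_none => u c cr.
by apply/negP => fc; apply: nf; exists (Ordinal cr).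
Qed.

Lemma lcost_union A B f : lcost (lg_union A B) f = lcost A f + lcost B f.
Proof.
apply/eqP; rewrite eqn_leq; apply/andP; split.
  have /min_deletionsP[g gP gm] := leqnn (lcost A f).
  have /min_deletionsP[h hP hm] := leqnn (lcost B f).
  apply: leq_trans (leq_add gm hm); apply/min_deletionsP.
  exists [ffun u => match u with inl v => g v | inr v => h v end].
    move/partial_coloringP: gP => gP; move/partial_coloringP: hP => hP.
    apply/partial_coloringP => -[u|u] c; rewrite ffunE.
      move=> /gP[fu Eu]; split=> // -[v|v] //= Euv; rewrite ffunE; exact: Eu.
    move=> /hP[fu Eu]; split=> // -[v|v] //= Euv; rewrite ffunE; exact: Eu.
  rewrite /num_deleted -!sum1dep_card big_sumType /=.
  by apply: leq_add; rewrite leq_eqVlt; apply/orP; left; apply/eqP;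
    apply: eq_bigl => u; rewrite ?inE ffunE.
have /min_deletionsP[g /partial_coloringP gP gm] :=
  leqnn (lcost (lg_union A B) f).
apply: leq_trans gm; pose g1 := [ffun u : A => g (inl u)].
pose g2 := [ffun u : B => g (inr u)].
have -> : num_deleted g = num_deleted g1 + num_deleted g2.
  rewrite /num_deleted -!sum1dep_card big_sumType /=.
  by congr (_ + _); apply: eq_bigl => u; rewrite ?inE ffunE.
apply: leq_add; apply/min_deletionsP; [exists g1|exists g2] => //;
  apply/partial_coloringP => u c; rewrite ffunE => /gP[fu Eu];
  split=> // v Euv; rewrite ffunE; exact: Eu.
Qed.

(** Vertices and edges stay the same, so the two sides are convertible. *)
Lemma lcost_relabel i j A f :
  lcost (lg_relabel i j A) f = lcost A (fun l => f (if l == i then j else l)).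
Proof. by []. Qed.

(* The join, with its new edges binding only for the colors below [q]. *)
Definition half_join i j A q : nat -> rel A := fun c u v =>
  edge u v || (c < q) && ((label u == i) && (label v == j) ||
                          (label u == j) && (label v == i)).

Lemma half_join0 i j A f : label_cost (@half_join i j A 0) f = lcost A f.
Proof.
apply: eq_min_deletions => g; split=> /partial_coloringP gP;
  apply/partial_coloringP => u c /gP[fu Eu]; split=> // v Euv; apply: Eu => //.
  by rewrite /half_join Euv.
by move: Euv; rewrite /half_join /= orbF.
Qed.

Lemma half_join_full i j (ij : i != j) A f :
  label_cost (@half_join i j A r) f = lcost (lg_join ij A) f.
Proof.
by apply: eq_min_deletions => g; split=> /partial_coloringP gP;
  apply/partial_coloringP => u c /gP[fu Eu]; split=> // v Euv; apply: Eu;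
  move: Euv; rewrite /half_join /= /join_edge ltn_ord /=.
Qed.

Definition forbid f i q : nat -> nat -> bool :=
  fun l c => f l c && ~~ ((l == i) && (c == q)).

(* In a coloring, color [q] is missing on label [i] or on label [j]. *)
Lemma half_joinS i j A q f (ij : i != j) : q < r ->
  label_cost (@half_join i j A q.+1) f =
  if f i q && f j q
  then minn (label_cost (@half_join i j A q) (forbid f i q))
            (label_cost (@half_join i j A q) (forbid f j q))
  else label_cost (@half_join i j A q) f.
Proof.
move=> qr.
have weaken l (g : {ffun A -> option 'I_r}) : l = i \/ l = j ->
    partial_coloring (@half_join i j A q) (fun u c => forbid f l q (label u) c) g ->
    partial_coloring (@half_join i j A q.+1) (fun u c => f (label u) c) g.
  move=> lij /partial_coloringP gP; apply/partial_coloringP => u c gu.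
  have [/andP[fu nu] Eu] := gP u c gu; split=> // v.
  rewrite /half_join ltnS leq_eqVlt.
  case: (eqVneq (c : nat) q) => [cq|_] /=; last exact: Eu.
  case/orP=> [Euv|uv]; first by apply: Eu; rewrite /half_join Euv.
  move=> gv; have [/andP[_ nv] _] := gP v c gv.
  move: nu nv; rewrite cq eqxx !andbT.
  by case: lij uv => ->; case/orP=> /andP[/eqP-> /eqP->]; rewrite !eqxx.
(* If some vertex labeled [i] has color [q], the new edges keep every vertex labeled [j] off that
   color, so label [j] can lose it. Otherwise label [i] can. *)
have strengthen (g : {ffun A -> option 'I_r}) : partial_coloring (@half_join i j A q.+1) (fun u c => f (label u) c) g ->
    exists2 l, l = i \/ l = j &
    partial_coloring (@half_join i j A q) (fun u c => forbid f l q (label u) c) g.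
  move=> /partial_coloringP gP.
  have sub (u : A) (c : 'I_r) (v : A) :
      half_join i j q c u v -> half_join i j q.+1 c u v.
    rewrite /half_join ltnS => /orP[->//|/andP[cq ->]].
    by rewrite (ltnW cq) orbT.
  case: (pickP (fun u : A => (label u == i) && (g u == Some (Ordinal qr)))).
    move=> u /andP[/eqP lu /eqP gu]; exists j; first by right.
    apply/partial_coloringP => v c gv; have [fv Ev] := gP v c gv.
    split; last by move=> w /sub /Ev.
    rewrite /forbid fv /=; apply/negP => /andP[/eqP lv /eqP cq].
    have [_ /(_ v)] := gP u _ gu; apply.
      by rewrite /half_join /= leqnn lu lv !eqxx orbT.
    by rewrite gv; congr Some; apply: val_inj.
  move=> no_u; exists i; first by left.
  apply/partial_coloringP => v c gv; have [fv Ev] := gP v c gv.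
  split; last by move=> w /sub /Ev.
  rewrite /forbid fv /=; apply/negP => /andP[/eqP lv /eqP cq].
  have cE : c = Ordinal qr by apply: val_inj; rewrite /= cq.
  by have := no_u v; rewrite /= lv eqxx gv cE eqxx.
have eqmin : label_cost (@half_join i j A q.+1) f =
    minn (label_cost (@half_join i j A q) (forbid f i q))
         (label_cost (@half_join i j A q) (forbid f j q)).
  apply/eqP; rewrite eqn_leq leq_min; apply/andP; split.
    apply/andP; split; apply: min_deletions_le => g; apply: weaken.
      by left.
    by right.
  have /min_deletionsP[g /strengthen[l lij gP] gm] :=
    leqnn (label_cost (@half_join i j A q.+1) f).
  rewrite geq_min; apply/orP.
  by case: lij gP => -> gP; [left|right]; apply: leq_trans gm; apply/min_deletionsP; exists g.
case: ifP => [_|/negbT]; first exact: eqmin.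
rewrite negb_and => nf.
(* Forbidding a color that [l] lacks already changes nothing. So [weaken] gives one inequality, and
   the other holds because stage [q] has fewer edges than the next one. *)
have [l lij fl] : exists2 l, l = i \/ l = j & ~~ f l q.
  by case/orP: nf => nf; [exists i|exists j] => //; [left|right].
have E : label_cost (@half_join i j A q) f = label_cost (@half_join i j A q) (forbid f l q).
  apply: eq_allowed => u c cr; rewrite /forbid.
  case: eqP => [->|] /=; last by rewrite andbT.
  by case: eqP => [->|_]; rewrite ?andbT // (negbTE fl).
apply/eqP; rewrite eqn_leq; apply/andP; split.
  by rewrite E; apply: min_deletions_le => g; apply: weaken.
apply: min_deletions_le => g /partial_coloringP gP.
apply/partial_coloringP => u c /gP[fu Eu]; split=> // v Euv; apply: Eu.
move: Euv; rewrite /half_join ltnS => /orP[->//|/andP[cq ->]].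
by rewrite (ltnW cq) orbT.
Qed.

End ExpressionCost.

(** * From the chromatic number to partial colorings *)

Lemma colorableW (G : sgraph) p q : p <= q -> colorable G p -> colorable G q.
Proof.
move=> pq /existsP[f fP]; apply/existsP.
exists [ffun u => widen_ord pq (f u)]; apply/forallP => u; apply/forallP => v.
apply/implyP => uv; rewrite !ffunE; have /implyP/(_ uv) := forallP (forallP fP u) v.
by apply: contra => /eqP/(congr1 val)/= H; apply/eqP/val_inj.
Qed.

Lemma chromatic_number_le (G : sgraph) q :
  (chromatic_number G <= q) = colorable G q.
Proof.
rewrite /chromatic_number; case: ex_minnP => p pG pmin.
by apply/idP/idP => [pq|/pmin//]; apply: colorableW pG.
Qed.

(** The deleted set corresponds to the vertices sent to [None], through the isomorphism. The
    absolute value forgets the sign of [b], hence the separate condition [0 <= b], which the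
    cardinality of the deleted set forces. *)
Lemma deletion_lcost r (G : sgraph) (b : int) (A : lgraph) : isomorphic A G ->
  deletion_to_colorable r G b <->
  (0 <= b)%R /\ lcost r A (fun _ _ => true) <= `|b|%N.
Proof.
move=> [h [h' hK h'K] hE]; split.
  case=> Y [Yb]; rewrite chromatic_number_le => /existsP[f fP].
  have b0 : (0 <= b)%R by apply: Order.POrderTheory.le_trans Yb.
  split=> //; apply/min_deletionsP.
  pose g := [ffun u : A => omap f (insub (h u) : option {v | v \notin Y})].
  exists g.
    apply/partial_coloringP => u c; rewrite ffunE; case: insubP => //= u' _ hu [fu].
    split=> // v Euv; rewrite ffunE; case: insubP => //= v' _ hv [fv].
    have uv' : edge (h u) (h v) by rewrite hE.
    rewrite -hu -hv in uv'.
    by have /implyP/(_ uv') := forallP (forallP fP u') v'; rewrite fu fv eqxx.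
  have -> : num_deleted g = #|Y|.
    rewrite -(on_card_preimset (onW_bij (mem Y) (Bijective hK h'K))); apply: eq_card => u.
    by rewrite !inE ffunE; case: insubP => [u' /negbTE-> //|/negPn->].
  by move: Yb; case: (b) b0.
case=> b0 /min_deletionsP[g /partial_coloringP gP gm].
exists [set v | g (h' v) == None]; split.
  have -> : #|[set v | g (h' v) == None]| = num_deleted g.
    rewrite /num_deleted -(on_card_preimset (onW_bij _ (Bijective h'K hK))).
    by apply: eq_card => v; rewrite !inE.
  by move: gm; case: (b) b0.
rewrite chromatic_number_le; apply/existsP.
set Y := [set v | _].
have gY (v : {v | v \notin Y}) : g (h' (val v)).
  by have := valP v; rewrite inE; case: (g _).
(* ['I_r] may be empty, so there is no default color to return; the proof [gY v] rules out [None]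
   instead. *)
exists [ffun v : {v | v \notin Y} =>
  match g (h' (val v)) as o return o -> 'I_r with
  | Some c => fun=> c | None => fun p => match notF p with end end (gY v)].
apply/forallP => u; apply/forallP => v; apply/implyP => /= uv; rewrite !ffunE.
move: (gY u) (gY v); case gu: (g (h' (val u))) => [c|] // _.
case gv: (g (h' (val v))) => [c'|] // _; apply/eqP => cc'.
have [_ /(_ (h' (val v)))] := gP _ _ gu; apply; last by rewrite gv cc'.
by rewrite -hE !h'K.
Qed.

(** * Binary digits *)

Definition bit (x e : nat) : bool := odd (x %/ 2 ^ e).

(** Clearing and setting are written arithmetically because the machine has no bit operations; the
    code for relabeling evaluates exactly this expression. *)
Definition set_bit (x a : nat) (v : bool) : nat :=
  x - bit x a * 2 ^ a + v * 2 ^ a.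

Lemma expn2_gt0 e : 0 < 2 ^ e. Proof. by rewrite expn_gt0. Qed.

(** Adding into a zero digit produces no carry, so the higher digits are unaffected. *)
Lemma divn_add_bit x a e : ~~ bit x a ->
  (x + 2 ^ a) %/ 2 ^ e = x %/ 2 ^ e + (e <= a) * 2 ^ (a - e).
Proof.
move=> xa; case: leqP => [ea|ae]; rewrite ?mul1n ?mul0n ?addn0.
  by rewrite -{1}(subnK ea) expnD divnDMl ?expn2_gt0.
have -> : 2 ^ e = 2 ^ a * 2 * 2 ^ (e - a.+1).
  by rewrite -expnSr -expnD subnKC.
rewrite !divnMA -{1}[2 ^ a]mul1n divnDMl ?expn2_gt0 //.
by rewrite addn1 !divn2 /= uphalf_half -/(bit x a) (negbTE xa).
Qed.

Lemma bit_add x a e : ~~ bit x a -> bit (x + 2 ^ a) e = (e == a) || bit x e.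
Proof.
move=> xa; rewrite /bit divn_add_bit // oddD oddM oddX orbF subn_eq0.
by case: ltngtP xa => [||->]; rewrite /bit /= ?addbF ?addbT // => _; rewrite addbF.
Qed.

Lemma bit_sub x a : bit x a ->
  [/\ 2 ^ a <= x, ~~ bit (x - 2 ^ a) a & x - 2 ^ a + 2 ^ a = x].
Proof.
move=> xa; have le : 2 ^ a <= x.
  by rewrite leqNgt; apply/negP => lt; rewrite /bit divn_small in xa.
have eqx : x - 2 ^ a + 2 ^ a = x by rewrite subnK.
split=> //; move: xa; rewrite /bit -{1}eqx -{2}[2 ^ a]mul1n divnDMl ?expn2_gt0 //.
by rewrite addn1.
Qed.

Lemma bit_set x a v e : bit (set_bit x a v) e = if e == a then v else bit x e.
Proof.
rewrite /set_bit; set y := x - _.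
have [ya yE] : ~~ bit y a /\ forall e, bit y e = (e != a) && bit x e.
  rewrite /y; case xa: (bit x a); rewrite ?mul1n ?mul0n ?subn0.
    have [_ ya xE] := bit_sub xa; split=> // e'.
    rewrite -{2}xE bit_add //; case: eqP => //= ->; exact: negbTE.
  by rewrite xa; split=> // e'; case: eqP => // ->.
case: v; rewrite ?mul1n ?mul0n ?addn0 ?bit_add // yE; by case: eqP.
Qed.

Lemma set_bit_lt x a v s : x < 2 ^ s -> a < s -> set_bit x a v < 2 ^ s.
Proof.
move=> xs as_; rewrite /set_bit; set y := x - _.
have ya : ~~ bit y a.
  rewrite /y; case xa: (bit x a); rewrite ?mul1n ?mul0n ?subn0 ?xa //.
  by have [] := bit_sub xa.
have ys : y < 2 ^ s := leq_ltn_trans (leq_subr _ _) xs.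
case: v; rewrite ?mul1n ?mul0n ?addn0 //.
have := divn_add_bit s ya; rewrite leqNgt as_ mul0n addn0 (divn_small ys).
by move=> E; rewrite ltnNge -divn_gt0 ?expn2_gt0 // E.
Qed.

Lemma bit_mod x s e : e < s -> bit (x %% 2 ^ s) e = bit x e.
Proof.
move=> es; rewrite /bit [in RHS](divn_eq x (2 ^ s)).
rewrite -{3}(subnK (ltnW es)) expnD mulnA divnMDl ?expn2_gt0 //.
by rewrite oddD oddM oddX subn_eq0 leqNgt es andbF.
Qed.

(** The colors of a label occupy [r] consecutive bits, so a single remainder tells whether any of
    them is allowed. *)
Lemma bits_mod x r : [exists c : 'I_r, bit x c] = (x %% 2 ^ r != 0).
Proof.
elim: r => [|r IH].
  by rewrite modn1; apply/existsP => -[[]].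
have -> : x %% 2 ^ r.+1 = bit x r * 2 ^ r + x %% 2 ^ r.
  rewrite expnSr [in LHS](divn_eq x (2 ^ r)) [in LHS](divn_eq (x %/ 2 ^ r) 2).
  rewrite mulnDl -mulnA [2 * _]mulnC -addnA modnMDl modn2 /bit modn_small //.
  have := ltn_pmod x (expn2_gt0 r); case: odd; lia.
rewrite addn_eq0 negb_and -IH muln_eq0 (gtn_eqF (expn2_gt0 r)) orbF eqb0 negbK.
apply/existsP/orP => [[c cx]|[xr|/existsP[c cx]]].
- have [cr|cr] : (c : nat) = r \/ c < r by have := ltn_ord c; lia.
    by left; rewrite -cr.
  by right; apply/existsP; exists (Ordinal cr).
- by exists ord_max.
- by exists (widen_ord (leqnSn r) c).
Qed.

Lemma bit_full s e : bit (2 ^ s - 1) e = (e < s).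
Proof.
elim: s e => [|s IH] e; first by rewrite /bit div0n.
have -> : 2 ^ s.+1 - 1 = 2 ^ s - 1 + 2 ^ s by rewrite expnS; have := expn2_gt0 s; lia.
by rewrite bit_add ?IH ?ltnn //; lia.
Qed.

Lemma bit0 e : bit 0 e = false. Proof. by rewrite /bit div0n. Qed.

(** Uniqueness of quotient and remainder modulo [r]: distinct pairs of a position and a color have
    distinct bits. *)
Lemma digit_bit_inj r a a' c c' : c < r -> c' < r ->
  (r * a + c == r * a' + c') = (a == a') && (c == c').
Proof.
move=> cr c'r; apply/eqP/andP => [E|[/eqP-> /eqP->]] //.
have r0 : 0 < r by apply: leq_ltn_trans cr.
have aE : a = a'.
  have /(congr1 (divn^~ r)) := E.
  by rewrite ![r * _]mulnC !divnMDl // !(divn_small (_ : _ < r)) // !addn0.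
by move: E; rewrite aE => /addnI ->; rewrite !eqxx.
Qed.

(** * Costs indexed by bit masks *)

(* The value 0 marks a label without a position, and division by it gives 0. *)
Definition weight (r : nat) (ls : seq nat) (l : nat) : nat :=
  if l \in ls then 2 ^ (r * index l ls) else 0.

Definition rows (r : nat) (ls : seq nat) : nat := 2 ^ (r * size ls).

(** A new label goes to the end, so the positions and weights of the others never change. *)
Definition add_label (ls : seq nat) (l : nat) : seq nat :=
  if l \in ls then ls else rcons ls l.

Section TableCost.
Variable r : nat.
Implicit Types (ls : seq nat) (A B : lgraph).

Definition allowed_set ls y : nat -> nat -> bool :=
  fun l c => (l \in ls) && bit y (r * index l ls + c).

Definition table_cost ls A y : nat := lcost r A (allowed_set ls y).

Definition covers ls A : Prop := forall u : A, label u \in ls.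

Lemma bit_position_lt ls i q : i \in ls -> q < r -> r * index i ls + q < r * size ls.
Proof.
rewrite -index_mem => ils qr; apply: leq_trans (_ : r * (index i ls).+1 <= _).
  by rewrite mulnS addnC ltn_add2r.
by rewrite leq_mul2l ils orbT.
Qed.

Lemma allowed_set_set_bit ls y i q v l c : i \in ls -> q < r -> c < r ->
  allowed_set ls (set_bit y (r * index i ls + q) v) l c =
  if (l == i) && (c == q) then v else allowed_set ls y l c.
Proof.
move=> ils qr cr; rewrite /allowed_set bit_set digit_bit_inj //.
case: (boolP (l \in ls)) => [lls|nls] /=; last by case: eqP nls => // ->; rewrite ils.
suff -> : (index l ls == index i ls) = (l == i) by [].
by apply/eqP/eqP => [|-> //]; exact: index_inj.
Qed.

Lemma covers_add_label ls A l : covers ls A -> covers (add_label ls l) A.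
Proof.
move=> lsA u; rewrite /add_label; case: ifP => // _.
by rewrite mem_rcons inE lsA orbT.
Qed.

Lemma mem_add_label ls l : l \in add_label ls l.
Proof. by rewrite /add_label; case: ifP => // _; rewrite mem_rcons inE eqxx. Qed.

(** A new label occupies the [r] highest bits, and no vertex of [A] bears it. The grown table
    therefore repeats the old one periodically. *)
Lemma table_cost_add_label ls A l y : covers ls A -> y < rows r (add_label ls l) ->
  table_cost (add_label ls l) A y = table_cost ls A (y %% rows r ls).
Proof.
move=> lsA; rewrite /add_label; case: ifP => [_ yS|_ _]; first by rewrite modn_small.
apply: eq_lcost => u c cr; have uls := lsA u.
rewrite /allowed_set mem_rcons inE uls orbT /= -cats1 index_cat uls bit_mod //.
exact: bit_position_lt.
Qed.

(** Dividing by the weight and taking the remainder extracts the bits of label [i]; truncated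
    subtraction from 1 then tests them for 0, as the program does. *)
Lemma table_cost_introduce ls i y : i \in ls ->
  table_cost ls (lg_introduce i) y = 1 - (y %/ weight r ls i) %% 2 ^ r.
Proof.
move=> ils; rewrite /table_cost lcost_introduce /weight ils.
have -> : [exists c : 'I_r, allowed_set ls y i c] =
    [exists c : 'I_r, bit (y %/ 2 ^ (r * index i ls)) c].
  by apply: eq_existsb => c; rewrite /allowed_set ils /bit expnD divnMA.
by rewrite bits_mod; case: (_ %% _).
Qed.

Lemma table_cost_union ls A B y :
  table_cost ls (lg_union A B) y = table_cost ls A y + table_cost ls B y.
Proof. exact: lcost_union. Qed.

(** Read as a mask, the weight of [i] is the single bit for color 0 at label [i]. It saves a
    deletion as soon as one vertex bears the label, because that vertex alone can be kept. *)
Lemma table_cost_present ls A i : 0 < r -> i \in ls -> covers ls A ->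
  (table_cost ls A 0 - table_cost ls A (weight r ls i) != 0) =
  [exists u : A, label u == i].
Proof.
move=> r0 ils lsA; rewrite subn_eq0 -ltnNge.
have -> : table_cost ls A 0 = #|A|.
  by apply: lcost_none => u c cr; rewrite /allowed_set bit0 andbF.
have wE l c : c < r -> allowed_set ls (weight r ls i) l c = (l == i) && (c == 0).
  move=> cr; have := allowed_set_set_bit 0 true l ils r0 cr.
  rewrite /set_bit bit0 mul0n subn0 mul1n addn0 add0n /weight ils => ->.
  by case: ifP => // _; rewrite /allowed_set bit0 andbF.
apply/idP/existsP => [lt|[u /eqP ui]].
  case: (pickP (fun u : A => label u == i)) => [u ui|none]; first by exists u.
  move: lt; rewrite /table_cost lcost_none ?ltnn // => u c cr.
  by rewrite wE // [label u == i]none.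
by apply: (@lcost_some _ _ _ u 0 r0); rewrite wE // ui !eqxx.
Qed.

Lemma lcost_relabel_absent A i j f : (forall u : A, label u != i) ->
  lcost r (lg_relabel i j A) f = lcost r A f.
Proof. by move=> noi; rewrite lcost_relabel; apply: eq_lcost => u c _; rewrite (negbTE (noi u)). Qed.

Lemma lcost_join_absent A i j (ij : i != j) f :
  (forall u : A, label u != i) \/ (forall u : A, label u != j) ->
  lcost r (lg_join ij A) f = lcost r A f.
Proof.
move=> no; have EE u v : join_edge i j u v = @edge A u v.
  rewrite /join_edge; case: no => no; rewrite !(negbTE (no _)) ?andbF ?orbF //.
apply: eq_min_deletions => g; split=> /partial_coloringP gP;
  apply/partial_coloringP => u c /gP[fu Eu]; split=> // v Euv; apply: Eu.
  by rewrite /= EE.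
by move: Euv; rewrite /= EE.
Qed.

Lemma table_cost_le ls A y : table_cost ls A y <= #|A|.
Proof. exact: lcost_le. Qed.

Lemma table_cost_relabel_absent ls A i j y : (forall u : A, label u != i) ->
  table_cost ls (lg_relabel i j A) y = table_cost ls A y.
Proof. exact: lcost_relabel_absent. Qed.

Lemma table_cost_join_absent ls A i j (ij : i != j) y :
  (forall u : A, label u != i) \/ (forall u : A, label u != j) ->
  table_cost ls (lg_join ij A) y = table_cost ls A y.
Proof. exact: lcost_join_absent. Qed.

Lemma table_cost_full ls A : covers ls A ->
  table_cost ls A (rows r ls - 1) = lcost r A (fun _ _ => true).
Proof.
move=> lsA; apply: eq_lcost => u c cr.
by rewrite /allowed_set lsA bit_full bit_position_lt.
Qed.

(** * Relabeling and joining one color at a time *)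

Section RelabelStages.
Variables (ls : seq nat) (A : lgraph) (i j : nat).
Hypotheses (ils : i \in ls) (jls : j \in ls).

(** Relabeling also proceeds color by color: a pass then alters a single bit of the mask and needs
    only two powers of 2, one for [i] and one for [j]. *)
Definition relabel_stage q y : nat :=
  lcost r A (fun l c => allowed_set ls y (if (l == i) && (c < q) then j else l) c).

Lemma relabel_stage0 y : relabel_stage 0 y = table_cost ls A y.
Proof. by apply: eq_lcost => u c _; rewrite andbF. Qed.

Lemma relabel_stage_last y : relabel_stage r y = table_cost ls (lg_relabel i j A) y.
Proof.
by rewrite /table_cost lcost_relabel; apply: eq_lcost => u c cr; rewrite cr andbT.
Qed.

(* The last equation says that the entry read is unaffected by the update, so
   that the table can be updated in place in any order. *)
Lemma relabel_stageS q y : q < r -> y < rows r ls ->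
  let z := set_bit y (r * index i ls + q) (bit y (r * index j ls + q)) in
  [/\ z < rows r ls, relabel_stage q.+1 y = relabel_stage q z
    & relabel_stage q.+1 z = relabel_stage q z].
Proof.
move=> qr yS z; split.
- by apply: set_bit_lt => //; apply: bit_position_lt.
- apply: eq_lcost => u c cr; rewrite /z allowed_set_set_bit // ltnS leq_eqVlt.
  case: (eqVneq (label u) i) => [->|ui] /=; last by rewrite (negbTE ui).
  case: (eqVneq c q) => [->|cq] /=; last by rewrite andbF.
  by rewrite ltnn eqxx /allowed_set jls.
apply: eq_lcost => u c cr; rewrite /z !allowed_set_set_bit // ltnS leq_eqVlt.
case: (eqVneq (label u) i) => [->|ui] //=.
case: (eqVneq c q) => [->|cq] //=.
by rewrite ltnn eqxx andbT /allowed_set jls; case: ifP.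
Qed.

End RelabelStages.

Section JoinStages.
Variables (ls : seq nat) (A : lgraph) (i j : nat).
Hypotheses (ils : i \in ls) (jls : j \in ls) (ij : i != j).

Definition join_stage q y : nat :=
  label_cost r (@half_join i j A q) (allowed_set ls y).

Lemma join_stage0 y : join_stage 0 y = table_cost ls A y.
Proof. exact: half_join0. Qed.

Lemma join_stage_last y : join_stage r y = table_cost ls (lg_join ij A) y.
Proof. exact: half_join_full. Qed.

(** Forbidding an allowed color clears one bit. The masks consulted are thus never above [y], and a
    downward pass has not yet overwritten their entries. *)
Lemma join_stageS q y : q < r ->
  let a := r * index i ls + q in let b := r * index j ls + q in
  join_stage q.+1 y =
  if bit y a && bit y b
  then minn (join_stage q (y - 2 ^ a)) (join_stage q (y - 2 ^ b))
  else join_stage q y.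
Proof.
move=> qr a b; rewrite /join_stage half_joinS // /allowed_set ils jls /=.
case: ifP => [/andP[ya yb]|_]; last by [].
have E l : l \in ls -> bit y (r * index l ls + q) ->
    label_cost r (@half_join i j A q) (forbid (allowed_set ls y) l q) =
    label_cost r (@half_join i j A q) (allowed_set ls (y - 2 ^ (r * index l ls + q))).
  move=> lls yl; apply: eq_allowed => u c cr.
  have -> : y - 2 ^ (r * index l ls + q) = set_bit y (r * index l ls + q) false.
    by rewrite /set_bit yl mul1n addn0.
  by rewrite allowed_set_set_bit // /forbid; case: ifP; rewrite ?andbF ?andbT.
by congr minn; apply: E.
Qed.

End JoinStages.
End TableCost.

Opaque table_cost relabel_stage join_stage.

(** * Running time of programs *)

Definition bounded (W : nat) (s : state) : Prop := forall c, Defs.mem s c <= W.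

(** An assignment is the most expensive step: its target address costs at most 2 bit lengths of [W],
    each of its two operands at most 3. *)
Definition unit_cost (W : nat) : nat := 1 + 8 * bitlen W.

(* [n] counts elementary steps; each costs at most [unit_cost W] as long as all
   addresses and values are at most [W]. *)
Definition runs (W : nat) (P : program) (s : state) (n : nat)
    (Q : state -> Prop) : Prop :=
  exists s' t, [/\ exec P s s' t, t <= n * unit_cost W & Q s'].

Lemma bitlen_le m n : m <= n -> bitlen m <= bitlen n.
Proof. by move=> mn; rewrite ltnS leq_trunc_log. Qed.

Lemma runs_weaken W P s n n' (Q Q' : state -> Prop) :
  runs W P s n Q -> n <= n' -> (forall s', Q s' -> Q' s') -> runs W P s n' Q'.
Proof.
move=> [s' [t [Pt tn Qs']]] nn' QQ'; exists s', t; split=> //; last exact: QQ'.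
by apply: leq_trans tn _; rewrite leq_mul2r nn' orbT.
Qed.

Lemma runs_leq W P s n n' Q : runs W P s n Q -> n <= n' -> runs W P s n' Q.
Proof. by move=> Ps nn'; apply: runs_weaken Ps nn' _. Qed.

Lemma runs_seq W P Q s n m R :
  runs W P s n (fun s' => runs W Q s' m R) -> runs W (Seq P Q) s (n + m) R.
Proof.
move=> [s' [t [Pt tn [s'' [t' [Qt' t'm Rs'']]]]]].
exists s'', (t + t'); split=> //; first exact: ExecSeq Pt Qt'.
by rewrite mulnDl leq_add.
Qed.

Lemma runs_skip W s R : R s -> runs W Skip s 1 R.
Proof. by move=> Rs; exists s, 1; split=> //; exact: ExecSkip. Qed.

Definition small_address (W : nat) (x : address) : bool :=
  match x with Direct a => a <= W | Indirect a => a <= W end.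

Definition small_operand (W : nat) (p : operand) : bool :=
  match p with Lit n => n <= W | Cell x => small_address W x end.

Section Costs.
Variables (W : nat) (s : state).
Hypothesis sW : bounded W s.

Lemma address_cost_le x : small_address W x ->
  address_cost (Defs.mem s) x <= 2 * bitlen W.
Proof.
case: x => a /= /bitlen_le aW; first by lia.
by have := bitlen_le (sW a); lia.
Qed.

Lemma operand_cost_le p : small_operand W p ->
  operand_cost (Defs.mem s) p <= 3 * bitlen W.
Proof.
case: p => [n|x] /= pW; first by move/bitlen_le: pW; lia.
have := address_cost_le pW; have := bitlen_le (sW (locate (Defs.mem s) x)); lia.
Qed.

End Costs.

Lemma runs_assign W x op p q M w R :
  bounded W (State M w) -> small_address W x -> small_operand W p -> small_operand W q ->
  R (State (write M (locate M x) (apply_binop op (value M p) (value M q))) w) ->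
  runs W (Assign x op p q) (State M w) 1 R.
Proof.
move=> sW xW pW qW Rs; do 2!eexists; split; [exact: ExecAssign| |exact: Rs].
have := address_cost_le sW xW; have := operand_cost_le sW pW.
have := operand_cost_le sW qW; rewrite /unit_cost /=; lia.
Qed.

Lemma runs_read W x M w R :
  bounded W (State M w) -> small_address W x -> head 0 w <= W ->
  R (State (write M (locate M x) (head 0 w)) (behead w)) ->
  runs W (Read x) (State M w) 1 R.
Proof.
move=> sW xW wW Rs; do 2!eexists; split; [exact: ExecRead| |exact: Rs].
have := address_cost_le sW xW; have := bitlen_le wW; rewrite /unit_cost /=; lia.
Qed.

Lemma runs_if W p P Q s n R :
  bounded W s -> small_operand W p ->
  (value (Defs.mem s) p != 0 -> runs W P s n R) ->
  (value (Defs.mem s) p = 0 -> runs W Q s n R) ->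
  runs W (IfNonzero p P Q) s n.+1 R.
Proof.
move=> sW pW HP HQ; have := operand_cost_le sW pW.
case: (eqVneq (value (Defs.mem s) p) 0) => [/[dup] p0 /HQ|/[dup] p0 /HP]
  [s' [t [e tn Rs']]] c.
  do 2!eexists; split; [exact: ExecIfFalse e| |exact: Rs'].
  by rewrite mulSn /unit_cost; move: tn; rewrite /unit_cost; lia.
do 2!eexists; split; [exact: ExecIfTrue e| |exact: Rs'].
by rewrite mulSn /unit_cost; move: tn; rewrite /unit_cost; lia.
Qed.

Lemma runs_while_step W p P s n m R :
  bounded W s -> small_operand W p -> value (Defs.mem s) p != 0 ->
  runs W P s n (fun s' => runs W (WhileNonzero p P) s' m R) ->
  runs W (WhileNonzero p P) s (n.+1 + m) R.
Proof.
move=> sW pW p0 [s' [t [e tn [s'' [t' [e' t'm Rs'']]]]]].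
have := operand_cost_le sW pW => c.
do 2!eexists; split; [exact: ExecWhileTrue e e'| |exact: Rs''].
by move: tn t'm; rewrite mulnDl mulSn /unit_cost; lia.
Qed.

Lemma runs_while_end W p P s R :
  bounded W s -> small_operand W p -> value (Defs.mem s) p = 0 -> R s ->
  runs W (WhileNonzero p P) s 1 R.
Proof.
move=> sW pW p0 Rs; have := operand_cost_le sW pW => c.
do 2!eexists; split; [exact: ExecWhileFalse p0| |exact: Rs].
by rewrite mul1n /unit_cost; lia.
Qed.

(** The index of the invariant counts the iterations left, so it serves as termination measure
    too. *)
Lemma runs_while W p P (I : nat -> state -> Prop) n j s R :
  small_operand W p -> (forall i s, I i s -> bounded W s) ->
  (forall i s, I i.+1 s -> value (Defs.mem s) p != 0 /\ runs W P s n (I i)) ->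
  (forall s, I 0 s -> value (Defs.mem s) p = 0) ->
  I j s -> (forall s, I 0 s -> R s) ->
  runs W (WhileNonzero p P) s (j * n.+1 + 1) R.
Proof.
move=> pW IW IS I0 Is IR; elim: j s Is => [|j IH] s Is.
  by apply: runs_while_end (IW _ _ Is) pW (I0 _ Is) (IR _ Is).
have [p0 Ps] := IS _ _ Is.
rewrite mulSn -addnA; apply: runs_while_step (IW _ _ Is) pW p0 _.
exact: runs_weaken Ps (leqnn _) IH.
Qed.

(** * Memory layout *)

Definition upd (D : nat -> nat) i a : nat -> nat :=
  fun j => if j == i then a else D j.

Definition upd2 (T : nat -> nat -> nat) x e a : nat -> nat -> nat :=
  fun y f => if (y == x) && (f == e) then a else T y f.

(* Cells 0-15 are registers, the even cells from 16 on hold the array [D], and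
   the odd ones hold the table [T], with rows of length [n]. *)
Definition memory (n : nat) (v : seq nat) (T : nat -> nat -> nat)
    (D : nat -> nat) : nat -> nat := fun c =>
  if c < 16 then nth 0 v c
  else if odd c then T ((c - 16)./2 %/ n) ((c - 16)./2 %% n)
  else D (c - 16)./2.

Lemma write_register n v T D a x : a < 16 ->
  write (memory n v T D) a x = memory n (set_nth 0 v a x) T D.
Proof.
move=> a16; apply: functional_extensionality => c; rewrite /write /memory.
rewrite nth_set_nth /=; case: eqP => [->|//]; by rewrite a16.
Qed.

Lemma memory_table n v T D x e : e < n ->
  memory n v T D (17 + 2 * (x * n + e)) = T x e.
Proof.
move=> en; rewrite /memory; set z := x * n + e.
have -> : (17 + 2 * z < 16) = false by lia.
have -> : (17 + 2 * z - 16)./2 = z by lia.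
rewrite oddD mul2n odd_double /= /z divnMDl ?modnMDl; last by lia.
by rewrite divn_small // modn_small // addn0.
Qed.

Lemma write_table n v T D x e a : e < n ->
  write (memory n v T D) (17 + 2 * (x * n + e)) a = memory n v (upd2 T x e a) D.
Proof.
move=> en; apply: functional_extensionality => c; rewrite /write.
case: eqP => [->|nc]; first by rewrite memory_table // /upd2 !eqxx.
rewrite /memory; case: ltnP => // c16; case: ifP => // oc; rewrite /upd2.
case: andP => // -[/eqP xE /eqP eE]; case: nc.
by have := divn_eq (c - 16)./2 n; rewrite xE eE; lia.
Qed.

Lemma memory_array n v T D i : memory n v T D (16 + 2 * i) = D i.
Proof.
rewrite /memory; have -> : (16 + 2 * i < 16) = false by lia.
have -> : (16 + 2 * i - 16)./2 = i by lia.
by rewrite oddD mul2n odd_double.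
Qed.

Lemma write_array n v T D i a :
  write (memory n v T D) (16 + 2 * i) a = memory n v T (upd D i a).
Proof.
apply: functional_extensionality => c; rewrite /write.
case: eqP => [->|nc]; first by rewrite memory_array /upd eqxx.
rewrite /memory; case: ltnP => // c16; case: ifP => // oc; rewrite /upd.
by case: eqP => // iE; case: nc; lia.
Qed.

Notation reg a := (Cell (Direct a)).

Definition register_operand (W : nat) (p : operand) : bool :=
  match p with
  | Lit n => n <= W
  | reg a => a < 16
  | Cell (Indirect a) => false
  end.

Definition register_value (v : seq nat) (p : operand) : nat :=
  match p with
  | Lit n => n
  | reg a => nth 0 v a
  | Cell (Indirect a) => 0
  end.

(** Truncated subtraction and division never exceed their first operand, so only sums and products
    need a bound. *)
Definition small_result (W : nat) (op : binop) (m n : nat) : bool :=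
  match op with Add => m + n <= W | Mul => m * n <= W | _ => true end.

Definition load a b := Assign (Direct a) Add (Cell (Indirect b)) (Lit 0).
Definition store b a := Assign (Indirect b) Add (reg a) (Lit 0).

Definition block (Ps : seq program) : program := foldr Seq Skip Ps.
Arguments block : simpl never.

Lemma runs_block W P Ps s n m R :
  runs W P s n (fun s' => runs W (block Ps) s' m R) ->
  runs W (block (P :: Ps)) s (n + m) R.
Proof. exact: runs_seq. Qed.

(** * Symbolic execution of single instructions *)

Section Registers.
Variables (W n : nat).
Hypothesis W16 : 16 <= W.

Definition config v T D w : state := State (memory n v T D) w.

Lemma value_register v T D p : register_operand W p ->
  value (memory n v T D) p = register_value v p.
Proof. by case: p => [//|[a|a]] //= a16; rewrite /memory a16. Qed.

Lemma register_small p : register_operand W p -> small_operand W p.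
Proof. by case: p => [//|[a|a]] //= a16; lia. Qed.

Lemma bounded_write M w a x : bounded W (State M w) -> x <= W ->
  bounded W (State (write M a x) w).
Proof. by move=> MW xW c; rewrite /= /write; case: ifP. Qed.

Lemma bounded_tape M w w' : bounded W (State M w) -> bounded W (State M w').
Proof. by []. Qed.

Lemma register_value_le v T D w p : bounded W (config v T D w) ->
  register_operand W p -> register_value v p <= W.
Proof.
move=> sW pW; rewrite -(value_register v T D pW).
by case: p pW => [//|x] _; apply: sW.
Qed.

(** The rest of the block appears as a continuation that is handed the boundedness of the new
    memory. Applying such rules one after another executes straight-line code symbolically. *)
Lemma runs_register a op p q Ps v T D w m R :
  bounded W (config v T D w) ->
  [&& a < 16, register_operand W p & register_operand W q] ->
  small_result W op (register_value v p) (register_value v q) ->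
  (let v' := set_nth 0 v a (apply_binop op (register_value v p) (register_value v q)) in
   bounded W (config v' T D w) -> runs W (block Ps) (config v' T D w) m R) ->
  runs W (block ((Assign (Direct a) op p q) :: Ps)) (config v T D w) m.+1 R.
Proof.
move=> sW /and3P[a16 pW qW] res cont; rewrite -add1n; apply: runs_seq.
apply: runs_assign (sW) _ (register_small pW) (register_small qW) _ => /=.
  by lia.
rewrite !value_register // write_register //; apply: cont.
rewrite /config -write_register //; apply: bounded_write => //.
have pv := register_value_le sW pW.
case: op res => //= _; first exact: leq_trans (leq_subr _ _) _.
exact: leq_trans (leq_div _ _) _.
Qed.

Lemma runs_load_table a b x e Ps v T D w m R :
  bounded W (config v T D w) -> (a < 16) && (b < 16) -> e < n ->
  nth 0 v b = 17 + 2 * (x * n + e) ->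
  (let v' := set_nth 0 v a (T x e) in
   bounded W (config v' T D w) -> runs W (block Ps) (config v' T D w) m R) ->
  runs W (block ((load a b) :: Ps)) (config v T D w) m.+1 R.
Proof.
move=> sW /andP[a16 b16] en vb cont; rewrite -add1n; apply: runs_seq.
apply: runs_assign (sW) _ _ _ _ => //=; try by lia.
have bE : memory n v T D b = 17 + 2 * (x * n + e) by rewrite /memory b16.
rewrite bE memory_table // addn0 write_register //; apply: cont.
rewrite /config -write_register //; apply: bounded_write => //.
by rewrite -(memory_table v T D x en); apply: sW.
Qed.

Lemma runs_load_array a b i Ps v T D w m R :
  bounded W (config v T D w) -> (a < 16) && (b < 16) ->
  nth 0 v b = 16 + 2 * i ->
  (let v' := set_nth 0 v a (D i) in
   bounded W (config v' T D w) -> runs W (block Ps) (config v' T D w) m R) ->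
  runs W (block ((load a b) :: Ps)) (config v T D w) m.+1 R.
Proof.
move=> sW /andP[a16 b16] vb cont; rewrite -add1n; apply: runs_seq.
apply: runs_assign (sW) _ _ _ _ => //=; try by lia.
have bE : memory n v T D b = 16 + 2 * i by rewrite /memory b16.
rewrite bE memory_array // addn0 write_register //; apply: cont.
rewrite /config -write_register //; apply: bounded_write => //.
by rewrite -(memory_array n v T D i); apply: sW.
Qed.

Lemma runs_store_table a b x e Ps v T D w m R :
  bounded W (config v T D w) -> (a < 16) && (b < 16) -> e < n ->
  nth 0 v b = 17 + 2 * (x * n + e) ->
  (let T' := upd2 T x e (nth 0 v a) in
   bounded W (config v T' D w) -> runs W (block Ps) (config v T' D w) m R) ->
  runs W (block ((store b a) :: Ps)) (config v T D w) m.+1 R.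
Proof.
move=> sW /andP[a16 b16] en vb cont; rewrite -add1n; apply: runs_seq.
apply: runs_assign (sW) _ _ _ _ => //=; try by lia.
have bE : memory n v T D b = 17 + 2 * (x * n + e) by rewrite /memory b16.
have aE : memory n v T D a = nth 0 v a by rewrite /memory a16.
rewrite bE aE addn0 write_table //; apply: cont.
by rewrite /config -write_table // -aE; apply: bounded_write => //; apply: sW.
Qed.

Lemma runs_store_array a b i Ps v T D w m R :
  bounded W (config v T D w) -> (a < 16) && (b < 16) ->
  nth 0 v b = 16 + 2 * i ->
  (let D' := upd D i (nth 0 v a) in
   bounded W (config v T D' w) -> runs W (block Ps) (config v T D' w) m R) ->
  runs W (block ((store b a) :: Ps)) (config v T D w) m.+1 R.
Proof.
move=> sW /andP[a16 b16] vb cont; rewrite -add1n; apply: runs_seq.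
apply: runs_assign (sW) _ _ _ _ => //=; try by lia.
have bE : memory n v T D b = 16 + 2 * i by rewrite /memory b16.
have aE : memory n v T D a = nth 0 v a by rewrite /memory a16.
rewrite bE aE addn0 write_array //; apply: cont.
by rewrite /config -write_array // -aE; apply: bounded_write => //; apply: sW.
Qed.

Lemma runs_read_register a Ps v T D w m R :
  bounded W (config v T D w) -> a < 16 -> head 0 w <= W ->
  (let v' := set_nth 0 v a (head 0 w) in
   bounded W (config v' T D (behead w)) ->
   runs W (block Ps) (config v' T D (behead w)) m R) ->
  runs W (block ((Read (Direct a)) :: Ps)) (config v T D w) m.+1 R.
Proof.
move=> sW a16 wW cont; rewrite -add1n; apply: runs_seq.
apply: runs_read (sW) _ (wW) _ => /=; first by lia.
rewrite write_register //; apply: cont.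
rewrite /config -write_register //.
exact: (bounded_tape (behead w) (bounded_write a sW wW)).
Qed.

Lemma runs_if_register a P Q v T D w m R :
  bounded W (config v T D w) -> a < 16 ->
  (nth 0 v a != 0 -> runs W P (config v T D w) m R) ->
  (nth 0 v a = 0 -> runs W Q (config v T D w) m R) ->
  runs W (IfNonzero (reg a) P Q) (config v T D w) m.+1 R.
Proof.
move=> sW a16 HP HQ.
have aE : memory n v T D a = nth 0 v a by rewrite /memory a16.
by apply: runs_if (sW) _ _ _ => /=; rewrite ?aE //; lia.
Qed.

End Registers.

Lemma runs_done W s m (R : state -> Prop) : 0 < m -> R s -> runs W Skip s m R.
Proof. by move=> m0 Rs; apply: runs_weaken (runs_skip W Rs) m0 _. Qed.

(** * The program and its execution *)

Definition assign a op p q : program := Assign (Direct a) op p q.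

Definition index_code a x e : seq program :=
  [:: assign a Mul (reg x) (reg 1); assign a Add (reg a) (reg e);
      assign a Mul (Lit 2) (reg a); assign a Add (Lit 17) (reg a)].

Definition fetch a x e : seq program := rcons (index_code a x e) (load a a).

Definition put x e a tmp : seq program := rcons (index_code tmp x e) (store tmp a).

(** There is no remainder instruction, so the parity of the quotient is what is left after
    subtracting twice its half. *)
Definition bit_code a x p tmp : seq program :=
  [:: assign a Div (reg x) (reg p); assign tmp Div (reg a) (Lit 2);
      assign tmp Mul (reg tmp) (Lit 2); assign a Defs.Sub (reg a) (reg tmp)].

Arguments fetch : simpl never.
Arguments put : simpl never.
Arguments bit_code : simpl never.

(* [x] runs downwards: at row [x], the rows up to [x] still hold the old table. *)
Definition column_loop (body : seq program) : seq program :=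
  [:: assign 9 Add (reg 3) (Lit 0);
      WhileNonzero (reg 9) (block (assign 9 Defs.Sub (reg 9) (Lit 1) :: body))].

Definition introduce_body (r : nat) : seq program :=
  [:: assign 10 Div (reg 9) (reg 7); assign 11 Div (reg 10) (Lit (2 ^ r));
      assign 11 Mul (reg 11) (Lit (2 ^ r)); assign 10 Defs.Sub (reg 10) (reg 11);
      assign 10 Defs.Sub (Lit 1) (reg 10)] ++ put 9 6 10 11 ++ [::].

Definition union_body : seq program :=
  fetch 10 9 6 ++ fetch 11 9 4 ++ assign 10 Add (reg 10) (reg 11) ::
  put 9 6 10 11 ++ [::].

Definition relabel_body : seq program :=
  bit_code 10 9 7 11 ++ bit_code 12 9 8 11 ++
  [:: assign 10 Mul (reg 10) (reg 7); assign 12 Mul (reg 12) (reg 7);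
      assign 10 Defs.Sub (reg 9) (reg 10); assign 10 Add (reg 10) (reg 12)] ++
  fetch 10 10 6 ++ put 9 6 10 11 ++ [::].

Definition join_body : seq program :=
  bit_code 10 9 7 11 ++ bit_code 12 9 8 11 ++
  [:: assign 10 Mul (reg 10) (reg 12); assign 12 Mul (reg 10) (reg 8);
      assign 12 Defs.Sub (reg 9) (reg 12); assign 10 Mul (reg 10) (reg 7);
      assign 10 Defs.Sub (reg 9) (reg 10)] ++
  fetch 10 10 6 ++ fetch 12 12 6 ++
  [:: assign 11 Defs.Sub (reg 10) (reg 12); assign 10 Defs.Sub (reg 10) (reg 11)] ++
  put 9 6 10 11 ++ [::].

Definition double_body : seq program :=
  [:: assign 9 Defs.Sub (reg 9) (Lit 1);
      assign 10 Mul (Lit 2) (reg 9); assign 10 Add (Lit 17) (reg 10); load 10 10;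
      assign 11 Mul (reg 3) (reg 1); assign 11 Add (reg 11) (reg 9);
      assign 11 Mul (Lit 2) (reg 11); assign 11 Add (Lit 17) (reg 11); store 11 10].

(** Appending a copy of all rows adds a highest mask bit on which no entry depends; [r] such
    doublings make room for one label. *)
Definition double : seq program :=
  [:: assign 9 Mul (reg 3) (reg 1); WhileNonzero (reg 9) (block double_body);
      assign 3 Mul (reg 3) (Lit 2)].

Definition array_address a : seq program :=
  [:: assign 10 Mul (Lit 2) (reg a); assign 10 Add (Lit 16) (reg 10)].

Definition lookup a : seq program := rcons (array_address a) (load a 10).

Definition grow (r : nat) : seq program := flatten (nseq r double).

(** The row count before growing is the weight of the new label, whose bits lie right above those in
    use. It is never 0, so it also marks the label as known. *)
Definition allocate (r a : nat) : seq program :=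
  lookup a ++
  [:: IfNonzero (reg a) Skip
        (block (store 10 3 :: assign a Add (reg 3) (Lit 0) :: grow r ++ [::]))].

(** Colors of a label are consecutive bits, so doubling both powers moves on to the next color. *)
Definition stage (body : seq program) : seq program :=
  column_loop body ++
  [:: assign 7 Add (reg 7) (reg 7); assign 8 Add (reg 8) (reg 8)].

Definition stages (r : nat) (body : seq program) : seq program :=
  flatten (nseq r (stage body)).

Lemma upd_weight r ls l : l \notin ls ->
  upd (weight r ls) l (rows r ls) = weight r (rcons ls l).
Proof.
move=> lls; apply: functional_extensionality => l'.
rewrite /upd /weight mem_rcons inE; case: (eqVneq l' l) => [->|l'l] /=.
  by rewrite -cats1 index_cat (negbTE lls) /= eqxx addn0.
by rewrite -cats1 index_cat; case: ifP.
Qed.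

Definition introduce_code (r : nat) : seq program :=
  Read (Direct 7) :: allocate r 7 ++ assign 6 Add (reg 4) (Lit 0) ::
  column_loop (introduce_body r) ++ [:: assign 4 Add (reg 4) (Lit 1)].

(** Decrementing the height before the loop makes register 4 the column of the popped table; the sum
    goes to the column below it. *)
Definition union_code : seq program :=
  [:: assign 4 Defs.Sub (reg 4) (Lit 1), assign 6 Defs.Sub (reg 4) (Lit 1)
    & column_loop union_body ++ [::]].

Definition relabel_code (r : nat) : seq program :=
  [:: Read (Direct 7), Read (Direct 8) & lookup 7 ++
  [:: IfNonzero (reg 7)
    (block [:: assign 6 Defs.Sub (reg 4) (Lit 1), assign 10 Mul (Lit 0) (Lit 0)
      & fetch 10 10 6 ++ fetch 11 7 6 ++
        [:: assign 10 Defs.Sub (reg 10) (reg 11);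
            IfNonzero (reg 10)
              (block (allocate r 8 ++ stages r relabel_body ++ [::])) Skip]])
    Skip]].

(** A label without a position is borne by no vertex, so a join that mentions one adds no edge and
    leaves the table alone. *)
Definition join_code (r : nat) : seq program :=
  [:: Read (Direct 7), Read (Direct 8) & lookup 7 ++ lookup 8 ++
  [:: IfNonzero (reg 7)
    (block [:: IfNonzero (reg 8)
      (block (assign 6 Defs.Sub (reg 4) (Lit 1) :: stages r join_body ++ [::]))
      Skip])
    Skip]].

Definition node_code (r op : nat) : seq program :=
  match op with
  | 1 => introduce_code r
  | 2 => union_code
  | 3 => relabel_code r
  | _ => join_code r
  end.

Definition step_code (r : nat) : seq program :=
  [:: assign 10 Defs.Sub (reg 2) (Lit 1);
      IfNonzero (reg 10)
        (block [:: assign 10 Defs.Sub (reg 10) (Lit 1);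
                   IfNonzero (reg 10)
                     (block [:: assign 10 Defs.Sub (reg 10) (Lit 1);
                                IfNonzero (reg 10) (block (node_code r 4))
                                  (block (node_code r 3))])
                     (block (node_code r 2))])
        (block (node_code r 1));
      Read (Direct 2)].

(** Opcodes are nonzero and the exhausted tape reads as 0, so the loop ends after the last node. *)
Definition main_loop (r : nat) : program :=
  WhileNonzero (reg 2) (block (step_code r)).

Definition skip_loop : program :=
  WhileNonzero (reg 9) (block [:: assign 9 Defs.Sub (reg 9) (Lit 1); Read (Direct 10)]).

(** Register 5 receives [b + 1], or 0 for negative [b], so that the final truncated difference is
    nonzero exactly if the cost is at most [b]. The entry read at the end is in the last row, whose
    mask allows everything. *)
Definition solver (r : nat) : program :=
  block [:: Read (Direct 1), assign 9 Mul (reg 1) (reg 1), skip_loop,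
    Read (Direct 10), Read (Direct 11), assign 10 Defs.Sub (Lit 1) (reg 10),
    assign 11 Add (reg 11) (Lit 1), assign 5 Mul (reg 10) (reg 11),
    assign 3 Add (Lit 1) (Lit 0), Read (Direct 2), main_loop r,
    assign 3 Defs.Sub (reg 3) (Lit 1), assign 6 Mul (Lit 0) (Lit 0)
    & fetch 10 3 6 ++ [:: assign 0 Defs.Sub (reg 5) (reg 10)]].

Lemma card_lg_union A B : #|lg_union A B| = #|A| + #|B|.
Proof. exact: card_sum. Qed.

Lemma card_eval_gt0 mu : 0 < #|eval mu|.
Proof.
elim: mu => [i|mu1 IH1 mu2 IH2|i j mu IH|i j ij mu IH] //=.
  by rewrite card_unit.
by rewrite card_lg_union addn_gt0 IH1.
Qed.

Lemma eval_label_range k mu : k_expression k mu ->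
  forall u : eval mu, 1 <= label u <= k.
Proof. by case: mu => [i|mu1 mu2|i j mu|i j ij mu] []. Qed.

(** * Correctness and step counts of the routines *)

Section Routines.
Variables (W n Smax r : nat).
Hypothesis n_gt0 : 0 < n.
Hypothesis W_large : 2 ^ r + 40 + 4 * (Smax.+1 * n.+1) <= W.

Notation cfg := (config n).

Let W16 : 16 <= W. Proof. by lia. Qed.

Ltac destruct_temporaries t := case: t => [|? [|? [|? [|? [|? [|? [|? ?]]]]]]] //.

Ltac register_step sW :=
  apply: (runs_register W16) (sW) _ _ _ => /=; [by lia| |move=> {}sW].

Lemma index_bound x e : x <= Smax -> e <= n -> 17 + 2 * (x * n + e) <= W.
Proof.
move=> xS en; have := leq_mul xS (leqnn n); move: W_large.
by rewrite mulSn mulnS; lia.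
Qed.

(** The target [a] may be [x], which only the first instruction reads, but not [e], which is read
    after [a] has been overwritten. *)
Lemma runs_index a x e Ps v T D w m R :
  bounded W (cfg v T D w) -> [&& a < 16, x < 16, e < 16, a != 1 & a != e] ->
  nth 0 v 1 = n -> nth 0 v x <= Smax -> nth 0 v e <= n ->
  (let v' := set_nth 0 v a (17 + 2 * (nth 0 v x * n + nth 0 v e)) in
   bounded W (cfg v' T D w) -> runs W (block Ps) (cfg v' T D w) m R) ->
  runs W (block (index_code a x e ++ Ps)) (cfg v T D w) m.+4 R.
Proof.
move=> sW /and5P[a16 x16 e16 a1 ae] vn vx ve cont.
have B := index_bound vx ve.
apply: (runs_register W16) (sW) _ _ _; rewrite /= ?a16 ?x16 ?vn //=; first by lia.
set v1 := set_nth 0 v a _ => sW1.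
have v1a : nth 0 v1 a = nth 0 v x * n by rewrite nth_set_nth /= eqxx.
have v1e : nth 0 v1 e = nth 0 v e by rewrite nth_set_nth /= eq_sym (negbTE ae).
apply: (runs_register W16) (sW1) _ _ _; rewrite /= ?a16 ?v1a ?v1e //; first by lia.
rewrite set_set_nth eqxx => sW2.
apply: (runs_register W16) (sW2) _ _ _; rewrite /= ?a16 ?nth_set_nth /= ?eqxx //; try by lia.
rewrite set_set_nth eqxx => sW3.
apply: (runs_register W16) (sW3) _ _ _; rewrite /= ?a16 ?nth_set_nth /= ?eqxx //; try by lia.
by rewrite set_set_nth eqxx => sW4; apply: cont.
Qed.

Lemma runs_fetch a x e Ps v T D w m R :
  bounded W (cfg v T D w) -> [&& a < 16, x < 16, e < 16, a != 1 & a != e] ->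
  nth 0 v 1 = n -> nth 0 v x <= Smax -> nth 0 v e < n ->
  (let v' := set_nth 0 v a (T (nth 0 v x) (nth 0 v e)) in
   bounded W (cfg v' T D w) -> runs W (block Ps) (cfg v' T D w) m R) ->
  runs W (block (fetch a x e ++ Ps)) (cfg v T D w) m.+4.+1 R.
Proof.
move=> sW ok vn vx ve cont; have /and5P[a16 _ _ _ _] := ok.
rewrite /fetch -cats1 -catA; apply: runs_index (sW) ok vn vx (ltnW ve) _.
move=> /= sW1; apply: (runs_load_table W16) (sW1) _ ve _ _; rewrite ?a16 //.
  by rewrite nth_set_nth /= eqxx.
by rewrite /= set_set_nth eqxx => sW2; apply: cont.
Qed.

Lemma runs_put a x e tmp Ps v T D w m R :
  bounded W (cfg v T D w) ->
  [&& tmp < 16, x < 16, e < 16, tmp != 1 & tmp != e] -> (a < 16) && (a != tmp) ->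
  nth 0 v 1 = n -> nth 0 v x <= Smax -> nth 0 v e < n ->
  (let v' := set_nth 0 v tmp (17 + 2 * (nth 0 v x * n + nth 0 v e)) in
   let T' := upd2 T (nth 0 v x) (nth 0 v e) (nth 0 v a) in
   bounded W (cfg v' T' D w) -> runs W (block Ps) (cfg v' T' D w) m R) ->
  runs W (block (put x e a tmp ++ Ps)) (cfg v T D w) m.+4.+1 R.
Proof.
move=> sW ok /andP[a16 atmp] vn vx ve cont; have /and5P[t16 _ _ _ _] := ok.
rewrite /put -cats1 -catA; apply: runs_index (sW) ok vn vx (ltnW ve) _.
move=> /= sW1; apply: (runs_store_table W16) (sW1) _ ve _ _; rewrite ?a16 ?t16 //.
  by rewrite nth_set_nth /= eqxx.
by rewrite nth_set_nth /= (negbTE atmp) => sW2; apply: cont.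
Qed.

Lemma runs_bit a x p tmp Ps v T D w m R :
  bounded W (cfg v T D w) ->
  [&& a < 16, x < 16, p < 16, tmp < 16 & tmp != a] ->
  (let y := nth 0 v x %/ nth 0 v p in
   let v' := set_nth 0 (set_nth 0 v tmp (y %/ 2 * 2)) a (odd y) in
   bounded W (cfg v' T D w) -> runs W (block Ps) (cfg v' T D w) m R) ->
  runs W (block (bit_code a x p tmp ++ Ps)) (cfg v T D w) m.+4 R.
Proof.
move=> sW /and5P[a16 x16 p16 t16 ta] cont; set y := _ %/ _ in cont.
have half_le z : z %/ 2 * 2 <= z by exact: leq_trunc_div.
apply: (runs_register W16) (sW) _ _ _; rewrite /= ?a16 ?x16 ?p16 //= -/y => sW1.
have yW : y <= W.
  have := sW1 a; rewrite /= /config /= /memory a16 nth_set_nth /= eqxx; exact.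
apply: (runs_register W16) (sW1) _ _ _ => //=.
  by rewrite ?a16 ?t16; lia.
rewrite nth_set_nth /= eqxx => sW2.
have at_ : (a == tmp) = false by rewrite eq_sym (negbTE ta).
apply: (runs_register W16) (sW2) _ _ _; rewrite /= ?t16 ?nth_set_nth /= ?eqxx.
- by lia.
- exact: leq_trans (half_le _) _.
rewrite set_set_nth eqxx => sW3.
apply: (runs_register W16) (sW3) _ _ _; rewrite /= ?a16 ?t16 //.
rewrite !nth_set_nth /= !eqxx at_ nth_set_nth /= eqxx.
have -> : y - y %/ 2 * 2 = odd y by have := divn_eq y 2; rewrite modn2; lia.
rewrite [set_nth 0 (set_nth 0 v a y) tmp _]set_set_nth at_ set_set_nth eqxx.
exact: cont.
Qed.

(* [n] number of columns, [S] number of rows, [d] height of the stack of tables,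
   [b] one more than the deletion budget (0 if that is negative), [c] the column
   being updated, [p] and [q] labels and then their weights, [x] loop counter. *)
Definition regs op S d b c p q x (t : seq nat) : seq nat :=
  [:: 0, n, op, S, d, b, c, p, q, x & t].

(** The body is offered the table in mid-pass, updated above row [x] only; what remains for each
    operation is that the entries it consults are right at that moment. A row costs the body plus
    the test and the decrement. *)
Lemma runs_column body k Ps op S d b c p q x t T F D w m R :
  S <= Smax -> c < n -> size t = 6 -> bounded W (cfg (regs op S d b c p q x t) T D w) ->
  (forall x t T', x < S -> size t = 6 ->
     bounded W (cfg (regs op S d b c p q x t) T' D w) ->
     (forall y e, y < S -> e < n ->
        T' y e = if (e == c) && (x < y) then F y else T y e) ->
     runs W (block body) (cfg (regs op S d b c p q x t) T' D w) k (fun s =>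
       exists2 t', size t' = 6 &
         let T'' := upd2 T' x c (F x) in
         s = cfg (regs op S d b c p q x t') T'' D w /\ bounded W s)) ->
  (forall t T', size t = 6 -> bounded W (cfg (regs op S d b c p q 0 t) T' D w) ->
     (forall y e, y < S -> e < n -> T' y e = if e == c then F y else T y e) ->
     runs W (block Ps) (cfg (regs op S d b c p q 0 t) T' D w) m R) ->
  runs W (block (column_loop body ++ Ps)) (cfg (regs op S d b c p q x t) T D w)
    (S * k.+2 + m.+2) R.
Proof.
move=> SS cn t6 sW Hbody cont; rewrite !addnS.
apply: (runs_register W16) (sW) _ _ _ => //=.
  by rewrite addn0; have := sW 3.
have -> : (S * k.+2 + m).+1 = S * k.+2 + 1 + m by lia.
rewrite addn0 => sW1.
apply: runs_block.
pose I j s := exists t' T', [/\ size t' = 6, j <= S,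
  s = cfg (regs op S d b c p q j t') T' D w, bounded W s &
  forall y e, y < S -> e < n ->
    T' y e = if (e == c) && (j <= y) then F y else T y e].
apply: (runs_while (I := I)) => //; first by rewrite /=; lia.
- by move=> j s [t' [T' []]].
- move=> j s [t' [T' [t'6 jS -> sW' T'E]]]; split=> //.
  apply: (runs_register W16) (sW') _ _ _ => //=; first by lia.
  rewrite subn1 /= => sW''.
  apply: runs_weaken (Hbody _ _ _ jS t'6 sW'' T'E) (leqnn _) _.
  move=> s' [t'' t''6 [-> sW3]]; exists t'', (upd2 T' j c (F j)); split=> //.
    exact: ltnW.
  move=> y e yS en; rewrite /upd2; case: (eqVneq e c) => [ec|ec].
    rewrite andbT leq_eqVlt [j == y]eq_sym; case: (eqVneq y j) => [->//|yj] /=.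
    by rewrite T'E // ec eqxx.
  by rewrite andbF T'E // (negbTE ec).
- by move=> s [t' [T' [_ _ -> _ _]]].
- exists t, T; split=> // y e yS en.
  by rewrite leqNgt yS andbF.
by move=> s [t' [T' [t'6 _ -> sW' T'E]]]; apply: cont => // y e yS en;
  rewrite T'E // andbT.
Qed.

Let Smax_le : Smax <= W.
Proof. by move: W_large; rewrite mulSn mulnS; lia. Qed.

(** The 40 is shared by the column lemmas of all four operations: 2 steps of loop control and 38 for
    the body, more than even the join needs. *)
Lemma runs_introduce_column Ps op S d b c p q x t T F D w m R :
  S <= Smax -> c < n -> size t = 6 -> bounded W (cfg (regs op S d b c p q x t) T D w) ->
  (forall y, y < S -> F y = 1 - (y %/ p) %% 2 ^ r) ->
  (forall t T', size t = 6 -> bounded W (cfg (regs op S d b c p q 0 t) T' D w) ->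
     (forall y e, y < S -> e < n -> T' y e = if e == c then F y else T y e) ->
     runs W (block Ps) (cfg (regs op S d b c p q 0 t) T' D w) m R) ->
  runs W (block (column_loop (introduce_body r) ++ Ps))
    (cfg (regs op S d b c p q x t) T D w) (S * 40 + m.+2) R.
Proof.
move=> SS cn t6 sW FE; apply: runs_column => // {x t t6 sW}.
move=> x t T' xS; destruct_temporaries t => _ sW T'E; rewrite /introduce_body.
have dE : x %/ p - x %/ p %/ 2 ^ r * 2 ^ r = (x %/ p) %% 2 ^ r.
  by have := divn_eq (x %/ p) (2 ^ r); lia.
have dW : x %/ p %/ 2 ^ r * 2 ^ r <= W.
  have := leq_trunc_div (x %/ p) (2 ^ r); have := leq_div x p.
  by have := Smax_le; lia.
register_step sW; first by [].
register_step sW; first by [].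
register_step sW; first by [].
register_step sW; first by [].
register_step sW; first by [].
rewrite dE -FE // in sW *.
apply: (runs_put (sW)) => //=; first by lia.
move=> {}sW; apply: runs_done => //.
by eexists [:: _; _; _; _; _; _].
Qed.

Lemma runs_union_column Ps op S d b c p q x t T F D w m R :
  S <= Smax -> c < n -> d < n -> d != c -> size t = 6 ->
  bounded W (cfg (regs op S d b c p q x t) T D w) ->
  (forall y, y < S -> F y = T y c + T y d) -> (forall y, y < S -> F y <= W) ->
  (forall t T', size t = 6 -> bounded W (cfg (regs op S d b c p q 0 t) T' D w) ->
     (forall y e, y < S -> e < n -> T' y e = if e == c then F y else T y e) ->
     runs W (block Ps) (cfg (regs op S d b c p q 0 t) T' D w) m R) ->
  runs W (block (column_loop union_body ++ Ps))
    (cfg (regs op S d b c p q x t) T D w) (S * 40 + m.+2) R.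
Proof.
move=> SS cn dn dc t6 sW FE FW; apply: runs_column => // {x t t6 sW}.
move=> x t T' xS; destruct_temporaries t => _ sW T'E; rewrite /union_body.
apply: (runs_fetch (sW)) => //=; first by lia.
move=> {}sW; apply: (runs_fetch (sW)) => //=; first by lia.
rewrite !T'E // ltnn andbF (negbTE dc) /= -?FE // => {}sW.
register_step sW; first by rewrite -FE ?FW.
rewrite -FE // in sW *.
apply: (runs_put (sW)) => //=; first by lia.
move=> {}sW; apply: runs_done => //.
by eexists [:: _; _; _; _; _; _].
Qed.

Lemma runs_relabel_column i j Ps op S d b c x t T F D w m R :
  S <= Smax -> c < n -> size t = 6 ->
  bounded W (cfg (regs op S d b c (2 ^ i) (2 ^ j) x t) T D w) ->
  (forall y, y < S -> let z := set_bit y i (bit y j) in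
     [/\ z < S, F y = T z c & F z = T z c]) ->
  (forall t T', size t = 6 ->
     bounded W (cfg (regs op S d b c (2 ^ i) (2 ^ j) 0 t) T' D w) ->
     (forall y e, y < S -> e < n -> T' y e = if e == c then F y else T y e) ->
     runs W (block Ps) (cfg (regs op S d b c (2 ^ i) (2 ^ j) 0 t) T' D w) m R) ->
  runs W (block (column_loop relabel_body ++ Ps))
    (cfg (regs op S d b c (2 ^ i) (2 ^ j) x t) T D w) (S * 40 + m.+2) R.
Proof.
move=> SS cn t6 sW FE; apply: runs_column => // {x t t6 sW}.
move=> x t T' xS; destruct_temporaries t => _ sW T'E; rewrite /relabel_body.
have [zS FxE FzE] := FE x xS.
have pW : 2 ^ i <= W := sW 7.
have small (v : bool) : v * 2 ^ i <= W by case: v; rewrite ?mul1n.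
apply: (runs_bit (sW)) => //= {}sW.
apply: (runs_bit (sW)) => //= {}sW.
register_step sW; first exact: small.
register_step sW; first exact: small.
register_step sW; first by [].
have zE : x - bit x i * 2 ^ i + bit x j * 2 ^ i = set_bit x i (bit x j) by [].
register_step sW; first by rewrite -/(bit x i) -/(bit x j) zE; have := Smax_le; lia.
rewrite -/(bit x i) -/(bit x j) zE in sW *.
apply: (runs_fetch (sW)) => //=; first by lia.
(* The row consulted may lie on either side of [x]; its entry is [F x] whether or not it has been
   updated. *)
have -> : T' (set_bit x i (bit x j)) c = F x.
  by rewrite T'E // eqxx FzE -FxE if_same.
move=> {}sW; apply: (runs_put (sW)) => //=; first by lia.
move=> {}sW; apply: runs_done => //.
by eexists [:: _; _; _; _; _; _].
Qed.

Lemma runs_join_column i j Ps op S d b c x t T F D w m R :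
  S <= Smax -> c < n -> size t = 6 ->
  bounded W (cfg (regs op S d b c (2 ^ i) (2 ^ j) x t) T D w) ->
  (forall y, y < S -> F y =
     if bit y i && bit y j then minn (T (y - 2 ^ i) c) (T (y - 2 ^ j) c)
     else T y c) ->
  (forall t T', size t = 6 ->
     bounded W (cfg (regs op S d b c (2 ^ i) (2 ^ j) 0 t) T' D w) ->
     (forall y e, y < S -> e < n -> T' y e = if e == c then F y else T y e) ->
     runs W (block Ps) (cfg (regs op S d b c (2 ^ i) (2 ^ j) 0 t) T' D w) m R) ->
  runs W (block (column_loop join_body ++ Ps))
    (cfg (regs op S d b c (2 ^ i) (2 ^ j) x t) T D w) (S * 40 + m.+2) R.
Proof.
move=> SS cn t6 sW FE; apply: runs_column => // {x t t6 sW}.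
move=> x t T' xS; destruct_temporaries t => _ sW T'E; rewrite /join_body.
have pW : 2 ^ i <= W := sW 7.
have qW : 2 ^ j <= W := sW 8.
apply: (runs_bit (sW)) => //= {}sW.
apply: (runs_bit (sW)) => //= {}sW.
have [v vE andE] : exists2 v, bit x i && bit x j = v & bit x i * bit x j = v.
  by exists (bit x i && bit x j); case: bit; case: bit.
have small a : a <= W -> v * a <= W by case: (v); rewrite ?mul1n.
register_step sW; first by rewrite -/(bit x i) -/(bit x j) andE; case: (v); lia.
rewrite -/(bit x i) -/(bit x j) andE in sW *.
register_step sW; first exact: small.
register_step sW; first by [].
register_step sW; first exact: small.
register_step sW; first by [].
have xW := leq_trans (ltnW xS) SS.
apply: (runs_fetch (sW)) => //=; first by lia.
move=> {}sW; apply: (runs_fetch (sW)) => //=; first by lia.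
have T'_below y : y <= x -> T' y c = T y c.
  by move=> yx; rewrite T'E ?(leq_ltn_trans yx) // ltnNge yx andbF.
rewrite !T'_below ?leq_subr // => {}sW.
register_step sW; first by [].
register_step sW; first by [].
have minE : T (x - v * 2 ^ i) c - (T (x - v * 2 ^ i) c - T (x - v * 2 ^ j) c) = F x.
  by rewrite FE // vE -minnE; case: (v); rewrite ?mul1n // minnn !subn0.
rewrite minE in sW *.
apply: (runs_put (sW)) => //=.
move=> {}sW; apply: runs_done => //.
by eexists [:: _; _; _; _; _; _].
Qed.

Lemma runs_double Ps op S d b c p q x t T D w m R :
  S * 2 <= Smax -> size t = 6 -> bounded W (cfg (regs op S d b c p q x t) T D w) ->
  (forall t T', size t = 6 ->
     bounded W (cfg (regs op (S * 2) d b c p q 0 t) T' D w) ->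
     (forall y e, y < S * 2 -> e < n -> T' y e = T (y %% S) e) ->
     runs W (block Ps) (cfg (regs op (S * 2) d b c p q 0 t) T' D w) m R) ->
  runs W (block (double ++ Ps)) (cfg (regs op S d b c p q x t) T D w)
    (S * n * 11 + m.+3) R.
Proof.
move=> SS t6 sW cont; rewrite /double.
have SnW : 17 + 2 * (S * 2 * n) <= W by have := index_bound SS (leq0n n); lia.
have -> : S * n * 11 + m.+3 = (S * n * 11 + 1 + m.+1).+1 by lia.
register_step sW; first by lia.
apply: runs_block.
(* The loop runs over flat cell indices, [j] of which are still to be copied; quotient and remainder
   by [n] give back row and column. *)
pose I j s := exists t' T', [/\ size t' = 6, j <= S * n,
  s = cfg (regs op S d b c p q j t') T' D w, bounded W s &
  forall y e, y < S -> e < n ->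
    T' y e = T y e /\ (j <= y * n + e -> T' (y + S) e = T y e)].
apply: (runs_while (I := I)) => //=; first by lia.
- by move=> j s [t' [T' []]].
- move=> j s [t' [T' [t'6 jS -> {}sW T'E]]]; split=> //.
  move: t'6 sW; destruct_temporaries t' => _ sW.
  have jn : j %% n < n by rewrite ltn_mod.
  have jE := divn_eq j n.
  have jS' : j %/ n < S by rewrite ltn_divLR.
  register_step sW; first by [].
  rewrite subn1 /= in sW *.
  register_step sW; first by lia.
  register_step sW; first by lia.
  apply: (runs_load_table W16 (x := j %/ n) (e := j %% n)) (sW) _ _ _ _ => //=.
    by rewrite -jE.
  move=> {}sW; register_step sW; first by lia.
  register_step sW; first by lia.
  register_step sW; first by lia.
  register_step sW; first by lia.
  apply: (runs_store_table W16 (x := j %/ n + S) (e := j %% n)) (sW) _ _ _ _ => //=.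
    by rewrite mulnDl addnAC -jE [j + _]addnC.
  move=> {}sW; apply: runs_done => //.
  eexists [:: _; _; _; _; _; _], _; split=> //; first exact: ltnW.
  move=> y e yS en; rewrite /upd2; have [T'ye T'yeS] := T'E y e yS en; split.
    by rewrite ifN // negb_and neq_ltn ltn_addl.
  rewrite eqn_add2r; case: andP => [[/eqP yE /eqP eE] _|ne jye].
    by have [-> _] := T'E _ _ jS' jn; rewrite yE eE.
  apply: T'yeS; rewrite ltn_neqAle jye andbT; apply: contra_notN ne => /eqP jE'.
  by rewrite jE' divnMDl // divn_small // modnMDl modn_small // addn0 !eqxx.
- by move=> s [t' [T' [_ _ -> _ _]]].
- exists t, T; split=> // y e yS en; split=> // Sny.
  by have := leq_mul yS (leqnn n); rewrite mulSn; lia.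
move=> s [t' [T' [t'6 _ -> {}sW T'E]]].
register_step sW; first by lia.
apply: cont => // y e yS en.
case: (ltnP y S) => [yS'|Sy]; first by rewrite modn_small // (T'E y e yS' en).1.
have ylt : y - S < S by lia.
have [_ /(_ (leq0n _))] := T'E (y - S) e ylt en; rewrite subnK // => ->.
by rewrite -{2}(subnK Sy) modnDr modn_small.
Qed.

(** Charging each doubling for a table of maximal size loses at most a factor [r], which is
    fixed. *)
Lemma runs_grow Ps op S d b c p q x t T D w m R :
  2 ^ r * S <= Smax -> size t = 6 -> bounded W (cfg (regs op S d b c p q x t) T D w) ->
  (forall x t T', size t = 6 ->
     bounded W (cfg (regs op (2 ^ r * S) d b c p q x t) T' D w) ->
     (forall y e, y < 2 ^ r * S -> e < n -> T' y e = T (y %% S) e) ->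
     runs W (block Ps) (cfg (regs op (2 ^ r * S) d b c p q x t) T' D w) m R) ->
  runs W (block (grow r ++ Ps)) (cfg (regs op S d b c p q x t) T D w)
    (r * (Smax * n * 11 + 3) + m) R.
Proof.
rewrite /grow => SS.
have : forall k S x t T, k <= r -> 2 ^ k * S <= Smax -> size t = 6 ->
  bounded W (cfg (regs op S d b c p q x t) T D w) ->
  (forall x t T', size t = 6 ->
     bounded W (cfg (regs op (2 ^ k * S) d b c p q x t) T' D w) ->
     (forall y e, y < 2 ^ k * S -> e < n -> T' y e = T (y %% S) e) ->
     runs W (block Ps) (cfg (regs op (2 ^ k * S) d b c p q x t) T' D w) m R) ->
  runs W (block (flatten (nseq k double) ++ Ps))
    (cfg (regs op S d b c p q x t) T D w) (k * (Smax * n * 11 + 3) + m) R.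
  elim=> [|k IH] {}S {}x {}t {}T kr {}SS t6 sW cont.
    by rewrite -[S]mul1n; apply: cont; rewrite ?mul1n // => y e yS en; rewrite modn_small.
  have Sk : 2 ^ k.+1 * S = 2 ^ k * (S * 2) by rewrite expnSr -mulnA [2 * S]mulnC.
  have S2 : S * 2 <= Smax.
    by rewrite Sk in SS; apply: leq_trans SS; rewrite leq_pmull ?expn_gt0.
  rewrite (_ : flatten (nseq k.+1 double) ++ Ps = double ++ (flatten (nseq k double) ++ Ps)) //.
  have SnE : S * n <= Smax * n by rewrite leq_mul2r; apply/orP; right; lia.
  apply: (@runs_leq _ _ _ (S * n * 11 + (k * (Smax * n * 11 + 3) + m).+3));
    [|by rewrite mulSn; lia].
  apply: runs_double => //.
  move=> t' T' t'6 {}sW T'E; apply: (IH) => //; [exact: ltnW|by rewrite -Sk|].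
  move=> x' t'' T'' t''6; rewrite -Sk => {}sW T''E; apply: cont => // y e yS en.
    rewrite T''E // T'E // ?ltn_pmod //; first by rewrite modn_dvdm // dvdn_mulr.
    by move: yS; rewrite Sk; case: (S * 2) => //; rewrite muln0.
move=> /(_ r S x t T (leqnn r) SS); exact.
Qed.

Lemma runs_lookup a Ps v T D w m R :
  a < 16 -> a != 10 -> 16 + 2 * nth 0 v a <= W -> bounded W (cfg v T D w) ->
  (let v' := set_nth 0 (set_nth 0 v 10 (16 + 2 * nth 0 v a)) a (D (nth 0 v a)) in
   bounded W (cfg v' T D w) -> runs W (block Ps) (cfg v' T D w) m R) ->
  runs W (block (lookup a ++ Ps)) (cfg v T D w) m.+3 R.
Proof.
move=> a16 a10 vW sW cont; rewrite /lookup -cats1 -catA.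
register_step sW; first by lia.
register_step sW; first by rewrite nth_set_nth /=; lia.
rewrite set_set_nth /= nth_set_nth /= in sW *.
apply: (runs_load_array W16 (i := nth 0 v a)) (sW) _ _ _ => //=; first by rewrite a16.
by rewrite nth_set_nth.
Qed.

Lemma runs_allocate ls a Ps op d b c p q x t T w l m R :
  a \in [:: 7; 8] -> nth 0 (regs op (rows r ls) d b c p q x t) a = l ->
  rows r (add_label ls l) <= Smax -> 16 + 2 * l <= W -> size t = 6 ->
  bounded W (cfg (regs op (rows r ls) d b c p q x t) T (weight r ls) w) ->
  (let S' := rows r (add_label ls l) in
   let D' := weight r (add_label ls l) in
   let v' x t := set_nth 0 (regs op S' d b c p q x t) a (D' l) in
   forall x t T', size t = 6 -> bounded W (cfg (v' x t) T' D' w) ->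
     (forall y e, y < S' -> e < n -> T' y e = T (y %% rows r ls) e) ->
     runs W (block Ps) (cfg (v' x t) T' D' w) m R) ->
  runs W (block (allocate r a ++ Ps))
    (cfg (regs op (rows r ls) d b c p q x t) T (weight r ls) w)
    (r * (Smax * n * 11 + 3) + 7 + m) R.
Proof.
move=> ha lE SS lW t6 sW; rewrite /allocate -catA.
have -> : r * (Smax * n * 11 + 3) + 7 + m = ((r * (Smax * n * 11 + 3) + 3).+1 + m).+3.
  by lia.
have a16 : (a < 16) && (a != 10) by move: ha; rewrite !inE => /orP[]/eqP->.
case/andP: a16 => a16 a10 cont.
apply: runs_lookup => //; rewrite lE // => v1 {}sW; rewrite {}/v1 in sW *.
apply: runs_block; apply: (runs_if_register W16) (sW) _ _ _ => //.
  rewrite nth_set_nth /= eqxx {1}/weight; case: ifP => // ils _.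
  apply: runs_done; first by rewrite addn3.
  move: sW cont; rewrite /add_label ils.
  move: t6 lE; destruct_temporaries t => _.
  move: ha; rewrite !inE => /orP[]/eqP-> /= _ sW;
    by apply => // y e yS en; rewrite modn_small.
rewrite nth_set_nth /= eqxx {1}/weight; case: ifP => [_|/negbT ils _].
  by move/eqP; rewrite expn_eq0.
have S'E : 2 ^ r * rows r ls = rows r (add_label ls l).
  by rewrite /add_label (negbTE ils) /rows size_rcons mulnS expnD.
have wE : weight r (add_label ls l) l = rows r ls.
  rewrite /add_label (negbTE ils) /weight mem_rcons inE eqxx /=.
  by rewrite -cats1 index_cat (negbTE ils) /= eqxx addn0.
have DE : upd (weight r ls) l (rows r ls) = weight r (add_label ls l).
  by rewrite upd_weight // /add_label (negbTE ils).
have -> : r * (Smax * n * 11 + 3) + 3 = (r * (Smax * n * 11 + 3) + 1).+2 by lia.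
have l0 : weight r ls l = 0 by rewrite /weight (negbTE ils).
rewrite wE in cont; rewrite l0 in sW *.
move: t6 lE sW; destruct_temporaries t => _ lE sW.
move: ha lE; rewrite !inE => /orP[]/eqP aE lE; rewrite aE /= in lE sW cont *;
  (apply: (runs_store_array W16 (i := l)) (sW) _ _ _ => //=; rewrite ?lE // ?DE => {}sW);
  (apply: (runs_register W16) (sW) _ _ _ => //=;
    first by rewrite addn0; have := sW 3);
  rewrite addn0 => {}sW;
  (apply: (runs_grow (t := [:: _; _; _; _; _; _])) => //; first by rewrite S'E);
  move=> x' t' T' t'6; rewrite S'E => {}sW T'E;
  by apply: runs_done => //; apply: cont.
Qed.

(** The bounds go up to [i + r] and [j + r], one past the last bits used, because the registers are
    doubled once more after the last color. *)
Lemma runs_stages body i j (F : nat -> nat -> nat) Ps op S d b c x t T D w m R :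
  2 ^ (i + r) <= W -> 2 ^ (j + r) <= W -> size t = 6 ->
  bounded W (cfg (regs op S d b c (2 ^ i) (2 ^ j) x t) T D w) ->
  (forall k x t T Ps m, k < r -> size t = 6 ->
     bounded W (cfg (regs op S d b c (2 ^ (i + k)) (2 ^ (j + k)) x t) T D w) ->
     (forall y, y < S -> T y c = F k y) ->
     (forall t T', size t = 6 ->
        bounded W (cfg (regs op S d b c (2 ^ (i + k)) (2 ^ (j + k)) 0 t) T' D w) ->
        (forall y e, y < S -> e < n -> T' y e = if e == c then F k.+1 y else T y e) ->
        runs W (block Ps)
          (cfg (regs op S d b c (2 ^ (i + k)) (2 ^ (j + k)) 0 t) T' D w) m R) ->
     runs W (block (column_loop body ++ Ps))
       (cfg (regs op S d b c (2 ^ (i + k)) (2 ^ (j + k)) x t) T D w)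
       (S * 40 + m.+2) R) ->
  c < n -> (forall y, y < S -> T y c = F 0 y) ->
  (forall p q x t T', size t = 6 -> bounded W (cfg (regs op S d b c p q x t) T' D w) ->
     (forall y e, y < S -> e < n -> T' y e = if e == c then F r y else T y e) ->
     runs W (block Ps) (cfg (regs op S d b c p q x t) T' D w) m R) ->
  runs W (block (stages r body ++ Ps))
    (cfg (regs op S d b c (2 ^ i) (2 ^ j) x t) T D w) (r * (S * 40 + 4) + m) R.
Proof.
move=> iW jW t6 sW Hcol cn T0 cont.
have : forall l k x t T1, k + l = r -> size t = 6 ->
  bounded W (cfg (regs op S d b c (2 ^ (i + k)) (2 ^ (j + k)) x t) T1 D w) ->
  (forall y e, y < S -> e < n -> T1 y e = if e == c then F k y else T y e) ->
  runs W (block (flatten (nseq l (stage body)) ++ Ps))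
    (cfg (regs op S d b c (2 ^ (i + k)) (2 ^ (j + k)) x t) T1 D w)
    (l * (S * 40 + 4) + m) R.
  elim=> [|l IH] k {}x {}t T1 kl {}t6 {}sW T1E.
    by rewrite addn0 in kl; subst k; apply: cont.
  rewrite (_ : flatten (nseq l.+1 (stage body)) ++ Ps = column_loop body ++
    [:: assign 7 Add (reg 7) (reg 7), assign 8 Add (reg 8) (reg 8)
      & flatten (nseq l (stage body)) ++ Ps]); last by [].
  have -> : l.+1 * (S * 40 + 4) + m = S * 40 + (l * (S * 40 + 4) + m).+2.+2.
    by rewrite mulSn; lia.
  have kr : k < r by lia.
  have pow a : a + r = a + k.+1 + l by lia.
  have double a : 2 ^ (a + k) + 2 ^ (a + k) = 2 ^ (a + k.+1).
    by rewrite addnn -mul2n -expnS addnS.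
  have powW a : 2 ^ (a + r) <= W -> 2 ^ (a + k) + 2 ^ (a + k) <= W.
    by apply: leq_trans; rewrite double pow leq_exp2l // leq_addr.
  apply: Hcol => //.
    by move=> y yS; rewrite T1E // eqxx.
  move=> t' T' t'6 {}sW T'E.
  apply: (runs_register W16) (sW) _ _ _ => //=; first exact: powW.
  move=> {}sW; apply: (runs_register W16) (sW) _ _ _ => //=; first exact: powW.
  rewrite !double => {}sW; apply: (IH) => //; first by lia.
  by move=> y e yS en; rewrite T'E // T1E //; case: (e == c).
move=> /(_ r 0 x t T (add0n r) t6); rewrite !addn0; apply=> // y e yS en.
by case: eqP => // ->; apply: T0.
Qed.

(** * The stack of tables and the code of each node *)

Variables (k b : nat) (toks : seq nat).
Hypothesis r_gt0 : 0 < r.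
Hypothesis toks_small : forall a, a \in toks -> 16 + 2 * a <= W.

Definition known_labels (ls : seq nat) : Prop :=
  [/\ uniq ls, forall l, l \in ls -> 1 <= l <= k & {subset ls <= toks}].

Hypothesis rows_small : forall ls, known_labels ls -> rows r ls <= Smax.

Let Smax_n_le : Smax * n + Smax + n <= W.
Proof. by move: W_large; rewrite mulSn mulnS; lia. Qed.

(* Column [e] holds the table of the [e]-th graph on the stack. *)
Definition stored (ls : seq nat) (st : seq lgraph) (T : nat -> nat -> nat) : Prop :=
  forall e, e < size st -> let A := nth (lg_introduce 0) st e in
  covers ls A /\ forall y, y < rows r ls -> T y e = table_cost r ls A y.

(** Describes the state before and after the code of a node, with the opcode in register 2 left open
    and the operands of the node still on the tape. *)
Definition settled (st : seq lgraph) (w : seq nat) (s : state) : Prop :=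
  exists ls T op c p q x t,
    [/\ known_labels ls, stored ls st T, size t = 6,
        s = cfg (regs op (rows r ls) (size st) b c p q x t) T (weight r ls) w &
        bounded W s].

(** A generous bound common to all operations; the dominant terms are [r] doublings of a table with
    at most [Smax * n] cells and [r] column passes. *)
Definition node_cost : nat := 200 * (r.+1 * (Smax * n).+1).

Lemma node_cost_ge :
  r * (Smax * n) * 100 + r * 100 + Smax * n * 100 + 100 <= node_cost.
Proof. by rewrite /node_cost mulSn mulnS; lia. Qed.

Lemma known_add_label ls l : known_labels ls -> 1 <= l <= k -> l \in toks ->
  known_labels (add_label ls l).
Proof.
move=> [lsU lsk lsT] lk lT; rewrite /add_label; case: ifP => [//|/negbT nl].
split; first by rewrite rcons_uniq nl.
  by move=> l'; rewrite mem_rcons inE => /orP[/eqP->|/lsk].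
by move=> l'; rewrite mem_rcons inE => /orP[/eqP->|/lsT].
Qed.

Lemma stored_add_label ls st T T' l : stored ls st T -> size st <= n ->
  (forall y e, y < rows r (add_label ls l) -> e < n ->
     T' y e = T (y %% rows r ls) e) ->
  stored (add_label ls l) st T'.
Proof.
move=> sT stn T'E e es; have [cov TE] := sT e es; split.
  exact: covers_add_label.
move=> y yS; rewrite (T'E _ _ yS (leq_trans es stn)) TE ?ltn_mod ?expn_gt0 ?table_cost_add_label //.
Qed.

Lemma token_le a : a \in toks -> a <= W.
Proof. by move/toks_small; lia. Qed.

Lemma rows_gt0 ls : 0 < rows r ls. Proof. by rewrite expn_gt0. Qed.

Lemma stage_weight_le ls i : known_labels ls -> i \in ls ->
  2 ^ (r * index i ls + r) <= W.
Proof.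
move=> /rows_small lsS ils; apply: leq_trans (_ : rows r ls <= _); last by lia.
rewrite /rows leq_exp2l // -mulnSr leq_mul2l.
by move: ils; rewrite -index_mem => ->; rewrite orbT.
Qed.

Lemma weight_lt_rows ls i : i \in ls -> weight r ls i < rows r ls.
Proof.
move=> ils; rewrite /weight ils ltn_exp2l // ltn_mul2l r_gt0 /=.
by rewrite index_mem.
Qed.

Lemma runs_introduce_code st i w s : settled st (i :: w) s -> size st < n ->
  1 <= i <= k -> i \in toks ->
  runs W (block (introduce_code r)) s node_cost (settled (rcons st (lg_introduce i)) w).
Proof.
move=> [ls [T [op [c [p [q [x [t [lsK sT t6 -> sW]]]]]]]]] stn ik iT.
have ls'K := known_add_label lsK ik iT.
have SS := rows_small ls'K.
have Sn : rows r (add_label ls i) <= Smax * n by rewrite (leq_trans SS) // leq_pmulr.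
rewrite /introduce_code.
apply: (@runs_leq _ _ _ (r * (Smax * n * 11 + 3) + 7 +
  (rows r (add_label ls i) * 40 + 2.+2).+1).+1);
  [|by have := node_cost_ge; lia].
apply: (runs_read_register W16) (sW) _ _ _ => //=; first exact: token_le.
move=> {}sW.
apply: (runs_allocate (l := i)) => //=; first exact: toks_small.
move=> {}x {}t T' {}t6 {}sW T'E.
move: t6 sW; destruct_temporaries t => _ sW.
register_step sW; first by lia.
rewrite addn0 in sW *.
apply: (runs_introduce_column (t := [:: _; _; _; _; _; _])
  (F := table_cost r (add_label ls i) (lg_introduce i))) => //.
  by move=> y _; rewrite table_cost_introduce // mem_add_label.
move=> t T'' t6 {}sW T''E.
register_step sW; first by lia.
apply: runs_done => //.
exists (add_label ls i), T''; do 6 eexists; split; [done| |exact: t6| |exact: sW].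
  have sT' := stored_add_label sT (ltnW stn) T'E.
  move=> e; rewrite size_rcons ltnS leq_eqVlt nth_rcons => /orP[/eqP->|es].
    rewrite ltnn eqxx; split; first by move=> u; apply: mem_add_label.
    by move=> y yS; rewrite T''E // eqxx.
  rewrite es; have [cov TE] := sT' e es; split=> // y yS.
  by rewrite T''E ?(ltn_trans es) // (ltn_eqF es) TE.
by rewrite size_rcons addn1.
Qed.

Lemma runs_union_code st A B w s : settled (rcons (rcons st A) B) w s ->
  (size st).+2 <= n -> #|A| + #|B| <= n ->
  runs W (block union_code) s node_cost (settled (rcons st (lg_union A B)) w).
Proof.
move=> [ls [T [op [c [p [q [x [t [lsK sT t6 -> sW]]]]]]]]] stn cardn.
have SS := rows_small lsK.
have Sn : rows r ls <= Smax * n by rewrite (leq_trans SS) // leq_pmulr.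
rewrite !size_rcons in sW *; rewrite /union_code.
apply: (@runs_leq _ _ _ (rows r ls * 40 + 1.+2).+2);
  [|by have := node_cost_ge; lia].
register_step sW; first by [].
register_step sW; first by [].
rewrite !subn1 /= in sW *.
have [covA TA] : covers ls A /\
    forall y, y < rows r ls -> T y (size st) = table_cost r ls A y.
  have := sT (size st); rewrite !size_rcons => /(_ (leqW (leqnn _))).
  by rewrite nth_rcons size_rcons leqnn nth_rcons ltnn eqxx.
have [covB TB] : covers ls B /\
    forall y, y < rows r ls -> T y (size st).+1 = table_cost r ls B y.
  have := sT (size st).+1; rewrite !size_rcons => /(_ (leqnn _)).
  by rewrite nth_rcons size_rcons ltnn eqxx.
apply: (runs_union_column (F := table_cost r ls (lg_union A B))) => //.
- by lia.
- by lia.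
- by move=> y yS; rewrite table_cost_union TA ?TB.
- move=> y yS; rewrite table_cost_union.
  by have := table_cost_le r ls A y; have := table_cost_le r ls B y; lia.
move=> {}t T' {}t6 {}sW T'E; apply: runs_done => //.
exists ls, T'; do 6 eexists; split; [done| |exact: t6| |exact: sW].
  move=> e; rewrite size_rcons ltnS leq_eqVlt nth_rcons => /orP[/eqP->|es].
    rewrite ltnn eqxx; split; first by case=> u; [apply: covA|apply: covB].
    by move=> y yS; rewrite T'E ?eqxx //; lia.
  rewrite es; have := sT e; rewrite !size_rcons !nth_rcons size_rcons.
  rewrite (leqW es) es => /(_ (leqW (leqW es)))[cov TE]; split=> // y yS.
  by rewrite T'E ?(ltn_eqF es) ?TE //; lia.
by rewrite size_rcons.
Qed.

Lemma stored_rcons ls st T A T' : stored ls st T -> size st < n ->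
  (forall y e, y < rows r ls -> e < size st -> T' y e = T y e) -> covers ls A ->
  (forall y, y < rows r ls -> T' y (size st) = table_cost r ls A y) ->
  stored ls (rcons st A) T'.
Proof.
move=> sT stn T'E cov T'A e; rewrite size_rcons ltnS leq_eqVlt nth_rcons.
case/orP=> [/eqP->|es]; first by rewrite ltnn eqxx.
by rewrite es; have [cov' TE] := sT e es; split=> // y yS; rewrite T'E ?TE.
Qed.

Lemma stored_belast ls st T A : stored ls (rcons st A) T ->
  [/\ stored ls st T, covers ls A &
      forall y, y < rows r ls -> T y (size st) = table_cost r ls A y].
Proof.
move=> sT; have := sT (size st); rewrite size_rcons nth_rcons ltnn eqxx.
move=> /(_ (leqnn _))[cov TA]; split=> // e es.
by have := sT e; rewrite size_rcons nth_rcons es => /(_ (leqW es)).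
Qed.

Lemma index_add_label ls l i : i \in ls -> index i (add_label ls l) = index i ls.
Proof.
by move=> ils; rewrite /add_label; case: (l \in ls); rewrite // -cats1 index_cat ils.
Qed.

Lemma runs_relabel_code st A i j w s : settled (rcons st A) (i :: j :: w) s ->
  size st < n -> (forall u : lg_relabel i j A, 1 <= label u <= k) ->
  i \in toks -> j \in toks ->
  runs W (block (relabel_code r)) s node_cost
    (settled (rcons st (lg_relabel i j A)) w).
Proof.
move=> [ls [T [op [c [p [q [x [t [lsK sT t6 -> sW]]]]]]]]] stn Bk iT jT.
have [sT' covA TA] := stored_belast sT.
(* Serves two cases: [i] has no position, or it has one but no vertex of [A] bears it. *)
have absent (T' : nat -> nat -> nat) p' q' c' x' t' :
    (forall u : A, label u != i) -> size t' = 6 -> T' = T ->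
    bounded W (cfg (regs op (rows r ls) (size st).+1 b c' p' q' x' t') T' (weight r ls) w) ->
    settled (rcons st (lg_relabel i j A)) w
      (cfg (regs op (rows r ls) (size st).+1 b c' p' q' x' t') T' (weight r ls) w).
  move=> noi t'6 -> {}sW; exists ls, T; do 6 eexists; split; [done| |exact: t'6| |exact: sW].
    apply: (stored_rcons sT' stn (fun _ _ _ _ => erefl)).
      by move=> u; rewrite /= (negbTE (noi u)); apply: covA.
    by move=> y yS; rewrite (TA _ yS) table_cost_relabel_absent.
  by rewrite size_rcons.
rewrite size_rcons in sW *; rewrite /relabel_code.
apply: (@runs_leq _ _ _ (((r * (Smax * n * 11 + 3) + 7 +
    (r * (Smax * n * 40 + 4) + 1)).+1 + 1).+4.+4.+4.+1.+1 + 1).+3.+2);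
  [|by have := node_cost_ge; lia].
apply: (runs_read_register W16) (sW) _ _ _ => //=; first exact: token_le.
move=> {}sW; apply: (runs_read_register W16) (sW) _ _ _ => //=; first exact: token_le.
move=> {}sW; apply: runs_lookup => //=; first exact: toks_small.
move: t6 sW; destruct_temporaries t => _ sW {}sW.
apply: runs_block; apply: (runs_if_register W16) (sW) _ _ _ => //=; last first.
  rewrite /weight; case: ifP => [_ /eqP|/negbT nls _]; first by rewrite expn_eq0.
  apply: runs_done => //; apply: runs_done => //.
  apply: (absent _ _ _ _ _ [:: _; _; _; _; _; _]) => //.
    by move=> u; apply: contra nls => /eqP <-.
  by rewrite /weight (negbTE nls) in sW.
rewrite {1}/weight; case: ifP => // ils _.
register_step sW; first by [].
rewrite subn1 /= in sW *.
register_step sW; first by [].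
apply: (runs_fetch (sW)) => //= {}sW.
have wlt := weight_lt_rows ils.
have SS := rows_small lsK.
apply: (runs_fetch (sW)) => //=; first by lia.
rewrite mul0n !TA ?rows_gt0 // => {}sW.
register_step sW; first by [].
apply: runs_block; apply: (runs_if_register W16) (sW) _ _ _ => //=; last first.
  move=> same; apply: runs_done; first by lia.
  do 2!apply: runs_done => //.
  apply: (absent _ _ _ _ _ [:: _; _; _; _; _; _]) => //.
  move=> u; apply/negP => ui.
  have := table_cost_present r_gt0 ils covA; rewrite same eqxx => /esym/existsP; apply.
  by exists u.
rewrite (table_cost_present r_gt0 ils covA) => /existsP[u0 u0i].
(* The vertex [u0] has label [j] in the relabeled graph, whose labels are in range. Only now may [j]
   receive a position. *)
have jk : 1 <= j <= k by have := Bk u0; rewrite /= u0i.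
have ls'K := known_add_label lsK jk jT.
have SS' := rows_small ls'K.
have ils' : i \in add_label ls j.
  by rewrite /add_label; case: (j \in ls); rewrite // mem_rcons inE ils orbT.
apply: (runs_allocate (l := j) (t := [:: _; _; _; _; _; _])) => //=.
  exact: toks_small.
move=> {}x t T' {}t6 {}sW T'E.
have sAn : size (rcons st A) <= n by rewrite size_rcons.
have [sT1 covA1 TA1] := stored_belast (stored_add_label sT sAn T'E).
have wE : weight r ls i = 2 ^ (r * index i (add_label ls j)).
  by rewrite index_add_label // /weight ils.
have wE' : weight r (add_label ls j) j = 2 ^ (r * index j (add_label ls j)).
  by rewrite /weight mem_add_label.
rewrite wE wE' in sW *.
have jls' := mem_add_label ls j.
have S'n : rows r (add_label ls j) <= Smax * n by rewrite (leq_trans SS') // leq_pmulr.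
apply: (@runs_leq _ _ _ (r * (rows r (add_label ls j) * 40 + 4) + 1));
  last by rewrite leq_add2r leq_mul2l leq_add2r leq_mul2r S'n !orbT.
apply: (runs_stages (F := relabel_stage r (add_label ls j) A i j)).
- exact: stage_weight_le.
- exact: stage_weight_le.
- exact: t6.
- exact: sW.
- move=> q0 {}x {}t T1 Ps m qr {}t6 {}sW TE cont.
  apply: (runs_relabel_column SS' stn t6 sW _ cont) => y yS.
  have [zS E1 E2] := relabel_stageS A ils' jls' qr yS.
  by split; rewrite ?(TE _ zS).
- exact: stn.
- by move=> y yS; rewrite relabel_stage0 TA1.
move=> {}p {}q {}x {}t T1 {}t6 {}sW T1E; do 3!apply: runs_done => //.
exists (add_label ls j), T1; do 6 eexists; split; [done| |exact: t6| |exact: sW].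
  apply: (stored_rcons sT1 stn).
  - by move=> y e yS es; rewrite (T1E _ _ yS (ltn_trans es stn)) (ltn_eqF es).
  - by move=> u; rewrite /=; case: ifP => _ //; apply: covA1.
  by move=> y yS; rewrite (T1E _ _ yS stn) eqxx relabel_stage_last.
by rewrite size_rcons.
Qed.

Lemma runs_join_code st A i j (ij : i != j) w s :
  settled (rcons st A) (i :: j :: w) s -> size st < n -> i \in toks -> j \in toks ->
  runs W (block (join_code r)) s node_cost
    (settled (rcons st (lg_join ij A)) w).
Proof.
move=> [ls [T [op [c [p [q [x [t [lsK sT t6 -> sW]]]]]]]]] stn iT jT.
have [sT' covA TA] := stored_belast sT.
have covJ : covers ls (lg_join ij A) := covA.
have absent p' q' c' x' t' :
    (forall u : A, label u != i) \/ (forall u : A, label u != j) -> size t' = 6 ->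
    bounded W (cfg (regs op (rows r ls) (size st).+1 b c' p' q' x' t') T (weight r ls) w) ->
    settled (rcons st (lg_join ij A)) w
      (cfg (regs op (rows r ls) (size st).+1 b c' p' q' x' t') T (weight r ls) w).
  move=> no t'6 {}sW; exists ls, T; do 6 eexists; split; [done| |exact: t'6| |exact: sW].
    apply: (stored_rcons sT' stn (fun _ _ _ _ => erefl) covJ) => y yS.
    by rewrite (TA _ yS) table_cost_join_absent.
  by rewrite size_rcons.
have unknown l : l \notin ls -> forall u : A, label u != l.
  by move=> nls u; apply: contra nls => /eqP <-.
rewrite size_rcons in sW *; rewrite /join_code.
apply: (@runs_leq _ _ _ (((r * (Smax * n * 40 + 4) + 1).+1.+1 + 1).+1 + 1).+3.+3.+2);
  [|by have := node_cost_ge; lia].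
apply: (runs_read_register W16) (sW) _ _ _ => //=; first exact: token_le.
move=> {}sW; apply: (runs_read_register W16) (sW) _ _ _ => //=; first exact: token_le.
move=> {}sW; apply: runs_lookup => //=; first exact: toks_small.
move: t6 sW; destruct_temporaries t => _ sW {}sW.
apply: runs_lookup => //=; first exact: toks_small.
move=> {}sW.
apply: runs_block; apply: (runs_if_register W16) (sW) _ _ _ => //=; last first.
  rewrite /weight; case: ifP => [_ /eqP|/negbT nls _]; first by rewrite expn_eq0.
  apply: runs_done => //; apply: runs_done => //.
  apply: (absent _ _ _ _ [:: _; _; _; _; _; _]); [by left; apply: unknown|by []|].
  by rewrite /weight (negbTE nls) in sW.
rewrite {1}/weight; case: ifP => // ils _.
apply: runs_block; apply: (runs_if_register W16) (sW) _ _ _ => //=; last first.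
  rewrite {1}/weight; case: ifP => [_ /eqP|/negbT nls _]; first by rewrite expn_eq0.
  apply: runs_done; first by lia.
  do 2!apply: runs_done => //.
  by apply: (absent _ _ _ _ [:: _; _; _; _; _; _]); [right; apply: unknown|by []|].
rewrite {1}/weight; case: ifP => // jls _.
register_step sW; first by [].
rewrite subn1 /= in sW *.
have SS := rows_small lsK.
have Sn : rows r ls <= Smax * n by rewrite (leq_trans SS) // leq_pmulr.
have wE l : l \in ls -> weight r ls l = 2 ^ (r * index l ls) by rewrite /weight => ->.
rewrite (wE _ ils) (wE _ jls) in sW *.
apply: (@runs_leq _ _ _ (r * (rows r ls * 40 + 4) + 1));
  last by rewrite leq_add2r leq_mul2l leq_add2r leq_mul2r Sn !orbT.
apply: (runs_stages (t := [:: _; _; _; _; _; _]) (F := join_stage r ls A i j)).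
- exact: stage_weight_le.
- exact: stage_weight_le.
- by [].
- exact: sW.
- move=> q0 {}x t T1 Ps m qr t6 {}sW TE cont.
  apply: (runs_join_column SS stn t6 sW _ cont) => y yS.
  rewrite join_stageS // !TE //; exact: leq_ltn_trans (leq_subr _ _) yS.
- exact: stn.
- by move=> y yS; rewrite join_stage0 TA.
move=> {}p {}q {}x t T1 t6 {}sW T1E; do 3!apply: runs_done => //.
exists ls, T1; do 6 eexists; split; [done| |exact: t6| |exact: sW].
  apply: (stored_rcons sT' stn _ covJ).
    by move=> y e yS es; rewrite (T1E _ _ yS (ltn_trans es stn)) (ltn_eqF es).
  by move=> y yS; rewrite (T1E _ _ yS stn) eqxx join_stage_last.
by rewrite size_rcons.
Qed.

(** The state at a loop test: the opcode has moved from the tape to register 2, and is 0 if the tape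
    was empty. *)
Definition ready (st : seq lgraph) (w : seq nat) (s : state) : Prop :=
  exists ls T c p q x t,
    [/\ known_labels ls, stored ls st T, size t = 6,
        s = cfg (regs (head 0 w) (rows r ls) (size st) b c p q x t) T
              (weight r ls) (behead w) &
        bounded W s].

Lemma head_le w : {subset w <= toks} -> head 0 w <= W.
Proof.
case: w => [//|a w] /(_ a); rewrite inE eqxx => /(_ isT)/toks_small /=; lia.
Qed.

Lemma runs_step op st st' w w' s : 1 <= op <= 4 ->
  (forall s, settled st w s ->
     runs W (block (node_code r op)) s node_cost (settled st' w')) ->
  {subset w' <= toks} -> ready st (op :: w) s ->
  runs W (block (step_code r)) s (node_cost + 10) (ready st' w').
Proof.
move=> op14 Hcode w'T [ls [T [c [p [q [x [t [lsK sT t6 -> sW]]]]]]]].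
have body t' : size t' = 6 ->
    let s' := cfg (regs op (rows r ls) (size st) b c p q x t') T (weight r ls) w in
    bounded W s' -> runs W (block (node_code r op)) s' node_cost (settled st' w').
  by move=> t'6 s' s'W; apply: Hcode; exists ls, T, op, c, p, q, x, t'; split.
have Hread s' : settled st' w' s' ->
    runs W (block [:: Read (Direct 2)]) s' 2 (ready st' w').
  move=> [ls' [T' [op' [c' [p' [q' [x' [t' [ls'K sT' t'6 -> sW']]]]]]]]].
  apply: (runs_read_register W16) (sW') _ _ _ => //=; first exact: head_le.
  by move=> {}sW'; apply: runs_done => //; exists ls', T', c', p', q', x', t'; split.
have seq_done P s' m : runs W P s' m (settled st' w') ->
    runs W (block [:: P]) s' (m + 1) (settled st' w').
  by move=> HP; apply: runs_block; apply: runs_weaken HP (leqnn _) _ => s'' Hs'';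
    apply: runs_done.
rewrite /step_code; move: t6 sW; destruct_temporaries t => _ sW.
have -> : node_cost + 10 = ((node_cost.+1 + 1).+1.+1 + 1).+1.+1 + 2.+1 by lia.
rewrite addnS.
register_step sW; first by [].
apply: runs_block.
apply: runs_weaken (_ : runs W _ _ _ (settled st' w')) (leqnn _) Hread.
apply: (runs_if_register W16) (sW) _ _ _ => //= op1; last first.
  have opE : op = 1 by lia.
  subst op; apply: runs_leq; first exact: (body [:: _; _; _; _; _; _]).
  by lia.
register_step sW; first by [].
apply: (seq_done).
apply: (runs_if_register W16) (sW) _ _ _ => //= op2; last first.
  have opE : op = 2 by lia.
  subst op; apply: runs_leq; first exact: (body [:: _; _; _; _; _; _]).
  by lia.
register_step sW; first by [].
apply: (seq_done).
apply: (runs_if_register W16) (sW) _ _ _ => //= op3; last first.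
  have opE : op = 3 by lia.
  by subst op; exact: (body [:: _; _; _; _; _; _]).
have opE : op = 4 by lia.
by subst op; exact: (body [:: _; _; _; _; _; _]).
Qed.

Lemma runs_iteration op st st' w w' s m R : 1 <= op <= 4 ->
  (forall s, settled st w s ->
     runs W (block (node_code r op)) s node_cost (settled st' w')) ->
  {subset w' <= toks} -> ready st (op :: w) s ->
  (forall s', ready st' w' s' -> runs W (main_loop r) s' m R) ->
  runs W (main_loop r) s (node_cost + 11 + m) R.
Proof.
move=> op14 Hcode w'T ws cont; have [ls [T [c [p [q [x [t [_ _ _ sE sW]]]]]]]] := ws.
have -> : node_cost + 11 + m = (node_cost + 10).+1 + m by lia.
apply: runs_while_step (sW) _ _ _; first by rewrite /=; lia.
  have op0 : op != 0 by lia.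
  by rewrite sE; exact: op0.
exact: runs_weaken (runs_step op14 Hcode w'T ws) (leqnn _) cont.
Qed.

(** The induction needs an arbitrary stack and an arbitrary rest of the tape. The bound on the stack
    survives a union because the first operand, which waits in one column, has at least one
    vertex. *)
Lemma runs_expression mu : forall st w m R s,
  k_expression k mu -> {subset encode_cexpr mu ++ w <= toks} ->
  size st + #|eval mu| <= n -> ready st (encode_cexpr mu ++ w) s ->
  (forall s', ready (rcons st (eval mu)) w s' -> runs W (main_loop r) s' m R) ->
  runs W (main_loop r) s (size (encode_cexpr mu) * (node_cost + 11) + m) R.
Proof.
elim: mu => [i|mu1 IH1 mu2 IH2|i j mu IH|i j ij mu IH] st w m R s muK wT stn ws cont.
- have wT' : {subset w <= toks} by move=> a aw; apply: wT; rewrite mem_cat aw orbT.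
  apply: (@runs_leq _ _ _ (node_cost + 11 + m)); last by rewrite /=; lia.
  apply: (runs_iteration (op := 1) (w := i :: w) _ _ wT' ws cont) => // s' ws'.
  apply: (runs_introduce_code ws').
  + by move: stn; rewrite /= card_unit addn1.
  + exact: (eval_label_range muK tt).
  + by apply: wT; rewrite !inE eqxx orbT.
- have [_ [mu1K mu2K]] := muK.
  have wE : encode_cexpr (Union mu1 mu2) ++ w =
      encode_cexpr mu1 ++ (encode_cexpr mu2 ++ (2 :: w)) by rewrite /= -!catA.
  rewrite wE in wT ws; rewrite [eval _]/= card_lg_union in stn.
  have c1 := card_eval_gt0 mu1; have c2 := card_eval_gt0 mu2.
  apply: (@runs_leq _ _ _ (size (encode_cexpr mu1) * (node_cost + 11) +
    (size (encode_cexpr mu2) * (node_cost + 11) + (node_cost + 11 + m))));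
    last by rewrite /= !size_cat /=; lia.
  apply: IH1 ws _ => //; first by lia.
  move=> s1 ws1; apply: IH2 ws1 _ => //.
    by move=> a aw; apply: wT; rewrite mem_cat aw orbT.
    by rewrite size_rcons; lia.
  move=> s2 ws2; apply: (runs_iteration (op := 2) _ _ _ ws2 cont) => //.
    move=> s3 ws3; apply: (runs_union_code ws3) => //; by lia.
  by move=> a aw; apply: wT; rewrite !mem_cat inE aw !orbT.
- have [_ mu1K] := muK; have lab := eval_label_range muK.
  have wE : encode_cexpr (Relabel i j mu) ++ w =
      encode_cexpr mu ++ [:: 3, i, j & w] by rewrite /= -catA.
  rewrite wE in wT ws; have c1 := card_eval_gt0 mu.
  apply: (@runs_leq _ _ _ (size (encode_cexpr mu) * (node_cost + 11) +
    (node_cost + 11 + m))); last by rewrite /= !size_cat /=; lia.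
  apply: IH ws _ => // s1 ws1.
  apply: (runs_iteration (op := 3) _ _ _ ws1 cont) => //.
    move=> s3 ws3.
    apply: (runs_relabel_code ws3) => //.
    - by have stn' : size st + #|eval mu| <= n := stn; lia.
    - by apply: wT; rewrite !mem_cat !inE eqxx !orbT.
    - by apply: wT; rewrite !mem_cat !inE eqxx !orbT.
  by move=> a aw; apply: wT; rewrite !mem_cat !inE aw !orbT.
have [_ mu1K] := muK.
have wE : encode_cexpr (Join ij mu) ++ w =
    encode_cexpr mu ++ [:: 4, i, j & w] by rewrite /= -catA.
rewrite wE in wT ws; have c1 := card_eval_gt0 mu.
apply: (@runs_leq _ _ _ (size (encode_cexpr mu) * (node_cost + 11) +
  (node_cost + 11 + m))); last by rewrite /= !size_cat /=; lia.
apply: IH ws _ => // s1 ws1.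
apply: (runs_iteration (op := 4) _ _ _ ws1 cont) => //.
  move=> s3 ws3.
  apply: (runs_join_code ij ws3) => //.
  - by have stn' : size st + #|eval mu| <= n := stn; lia.
  - by apply: wT; rewrite !mem_cat !inE eqxx !orbT.
  - by apply: wT; rewrite !mem_cat !inE eqxx !orbT.
by move=> a aw; apply: wT; rewrite !mem_cat !inE aw !orbT.
Qed.

Definition skip_config j x t T D w : state :=
  cfg [:: 0, n, 0, 0, 0, 0, 0, 0, 0, j, x & t] T D w.

Lemma runs_skip_loop (u w : seq nat) T D x t m R Ps :
  (forall a, a \in u -> a <= W) ->
  bounded W (skip_config (size u) x t T D (u ++ w)) ->
  (forall x, bounded W (skip_config 0 x t T D w) ->
     runs W (block Ps) (skip_config 0 x t T D w) m R) ->
  runs W (block (skip_loop :: Ps)) (skip_config (size u) x t T D (u ++ w))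
    (size u * 4 + 1 + m) R.
Proof.
move=> uW sW cont; apply: runs_block.
pose I j s' := exists u' x', [/\ size u' = j, forall a, a \in u' -> a <= W,
  s' = skip_config j x' t T D (u' ++ w) & bounded W s'].
apply: (runs_while (I := I) (n := 3)) => //=; first by lia.
- by move=> j s' [u' [x' []]].
- move=> j s' [u' [x' [u'j u'W -> {}sW]]]; split=> //.
  register_step sW; first by [].
  rewrite subn1 /= in sW *.
  case: u' u'j u'W sW => [//|a u'] [u'j] u'W sW.
  apply: (runs_read_register W16) (sW) _ _ _ => //=; first by apply: u'W; rewrite inE eqxx.
  move=> {}sW; apply: runs_done => //; exists u', a; split=> // c cu.
  by apply: u'W; rewrite inE cu orbT.
- by move=> s' [u' [x' [_ _ -> _]]].
- by exists u, x.
move=> s' [u' [x' [u'0 _ -> {}sW]]]; move: u'0 sW => /size0nil -> {}sW.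
exact: cont.
Qed.

(** Zeroed memory fits the layout for row length [n] even before [n] has been read. *)
Lemma initial_config w : initial w = cfg (nseq 16 0) (fun _ _ => 0) (fun _ => 0) w.
Proof.
congr State; apply: functional_extensionality => c; rewrite /memory.
by case: ltnP => c16; [rewrite nth_nseq c16|case: odd].
Qed.

Lemma runs_solver mu u sgn a : k_expression k mu -> #|eval mu| = n ->
  size u = n * n -> n * n <= W -> b = (1 - sgn) * (a + 1) ->
  {subset n :: u ++ sgn :: a :: encode_cexpr mu <= toks} ->
  runs W (solver r) (initial (n :: u ++ sgn :: a :: encode_cexpr mu))
    (n * n * 4 + size (encode_cexpr mu) * (node_cost + 11) + 30)
    (fun s => Defs.mem s 0 = b - lcost r (eval mu) (fun _ _ => true)).
Proof.
move=> muK mun un nnW bE wT; rewrite initial_config /solver.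
have sW : bounded W (cfg (nseq 16 0) (fun _ _ => 0) (fun _ => 0)
    (n :: u ++ sgn :: a :: encode_cexpr mu)) by rewrite -initial_config.
have small c : c \in n :: u ++ sgn :: a :: encode_cexpr mu -> 16 + 2 * c <= W.
  by move/wT/toks_small.
have nW := small n (mem_head _ _).
have sgnW : 16 + 2 * sgn <= W by apply: small; rewrite !(inE, mem_cat) eqxx !orbT.
have aW : 16 + 2 * a <= W by apply: small; rewrite !(inE, mem_cat) eqxx !orbT.
have muT : {subset encode_cexpr mu <= toks}.
  by move=> c cmu; apply: wT; rewrite !(inE, mem_cat) cmu !orbT.
have -> : n * n * 4 + size (encode_cexpr mu) * (node_cost + 11) + 30 =
    (n * n * 4 + 1 + (size (encode_cexpr mu) * (node_cost + 11) + 1 + 19).+4.+3).+2 by lia.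
apply: (runs_read_register W16) (sW) _ _ _ => //=; first by lia.
move=> {}sW; register_step sW; first by [].
rewrite -un in sW *.
apply: (runs_skip_loop (x := 0) (t := [:: 0; 0; 0; 0; 0]) _ sW) => //.
  move=> c cu; have : 16 + 2 * c <= W by apply: small; rewrite !(inE, mem_cat) cu !orbT.
  by lia.
move=> x {}sW.
apply: (runs_read_register W16) (sW) _ _ _ => //=; first by lia.
move=> {}sW; apply: (runs_read_register W16) (sW) _ _ _ => //=; first by lia.
move=> {}sW; register_step sW; first by [].
register_step sW; first by lia.
register_step sW.
  by case: (sgn) => [|?]; rewrite ?subn0 ?mul1n ?subSS ?sub0n ?mul0n //; lia.
rewrite -bE in sW *.
register_step sW; first by lia.
apply: (runs_read_register W16) (sW) _ _ _ => //=; first exact: head_le.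
rewrite addn0 => {}sW; apply: runs_block.
apply: (runs_expression (st := [::]) (w := [::]) muK) => //.
- by move=> c; rewrite cats0; apply: muT.
- by rewrite add0n mun.
(* With no label known, the empty mask is the only one, hence the initial row count 1. *)
- rewrite cats0; exists [::], (fun _ _ => 0), 0, 0, 0, 0.
  exists [:: 1 - sgn; a + 1; 0; 0; 0; 0]; split=> //.
  by rewrite /rows muln0.
move=> s' [ls [T [c [p [q [x' [t [lsK sT t6 -> {}sW]]]]]]]].
have [_ cov TE] := stored_belast (st := [::]) sT.
have Sn := rows_small lsK.
have S0 : 0 < rows r ls by rewrite expn_gt0.
apply: runs_while_end (sW) _ _ _ => //=; first by lia.
move: t6 sW; destruct_temporaries t => _ sW.
register_step sW; first by [].
register_step sW; first by [].
apply: (runs_fetch (sW)) => //=; first by lia.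
move=> {}sW; register_step sW; first by [].
apply: runs_done => //=; rewrite mul0n TE; last by lia.
by rewrite table_cost_full.
Qed.

End Routines.

(** * Size of the numbers and total running time *)

Lemma bitlen_gt0 a : 0 < bitlen a. Proof. by []. Qed.

Lemma size_le_input_size w : size w <= input_size w.
Proof.
by rewrite /input_size -sum1_size; apply: leq_sum => a _; apply: bitlen_gt0.
Qed.

Lemma token_lt w a : a \in w -> a < 2 ^ input_size w.
Proof.
move=> aw; apply: leq_trans (trunc_log_ltn a (isT : 1 < 2)) _; rewrite leq_exp2l //.
by rewrite /input_size (big_rem a) //= leq_addr.
Qed.

Lemma known_labels_size k w ls : known_labels k w ls -> size ls <= minn k (size w).
Proof.
move=> [lsU lsk lsw]; rewrite leq_min (uniq_leq_size lsU lsw) andbT.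
rewrite -[k in _ <= k](size_iota 1); apply: uniq_leq_size => // l /lsk lk.
by rewrite mem_iota; lia.
Qed.

Theorem theorem5p1 (r : nat) (hr : 1 <= r) :
  exists (P : program) (c d : nat),
    forall (G : sgraph) (b : int) (k : nat) (mu : cexpr),
      k_expression_for k mu G ->
      exists (s : state) (t : nat),
        [/\ exec P (initial (encode_instance G b mu)) s t,
            accepting s <-> deletion_to_colorable r G b
          & t <= c * input_size (encode_instance G b mu) ^ d * (2 ^ r) ^ k].
Proof.
(* With at most [S] rows and input size [N], there are at most [1000 * r.+1 * S * N ^ 2] steps, one
   factor [N] for the nodes and one for the columns. Each step costs at most [(8 * r + 65) * N]. *)
exists (solver r), (1000 * r.+1 * (8 * r + 65)), 3 => G b k mu [muK isoG].
set w := encode_instance G b mu; set N := input_size w.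
set u := [seq nat_of_bool (edge u v) | u <- enum G, v <- enum G].
have wE : w = #|G| :: u ++ (nat_of_bool (b < 0)%R) :: `|b|%N :: encode_cexpr mu by [].
have cardG : #|eval mu| = #|G|.
  by have [h hbij _] := isoG; apply: bij_eq_card hbij.
have n_gt0 : 0 < #|G| by rewrite -cardG card_eval_gt0.
have uG : size u = #|G| * #|G| by rewrite size_allpairs -cardE.
have szw : size w = #|G| * #|G| + size (encode_cexpr mu) + 3.
  by rewrite wE /= size_cat uG /=; lia.
have wN : size w <= N := size_le_input_size w.
have nN : #|G| <= N by have := leq_pmulr #|G| n_gt0; lia.
(* The side of [k] gives the factor in the time bound; the side of [N] keeps addresses short however
   large [k] is. *)
set S := 2 ^ (r * minn k N).
have SN : S <= 2 ^ (r * N) by rewrite leq_exp2l // leq_mul2l geq_minr orbT.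
have NN : N < 2 ^ N by apply: ltn_expl.
(* [2 ^ (r * N)] bounds the rows, [2 ^ N] the columns and all input numbers; the remaining factor 64
   absorbs the constants of the memory layout. *)
pose W := 2 ^ (r * N + N + 6).
have S_gt0 : 0 < S by rewrite expn_gt0.
have WE : W = 64 * (2 ^ (r * N) * 2 ^ N) by rewrite /W !expnD mulnC.
have W1 : S.+1 * #|G|.+1 <= 4 * (2 ^ (r * N) * 2 ^ N).
  have : S.+1 * #|G|.+1 <= (2 * 2 ^ (r * N)) * (2 * 2 ^ N) by apply: leq_mul; lia.
  by lia.
have WN : 2 ^ N <= 2 ^ (r * N) * 2 ^ N by rewrite leq_pmull // expn_gt0.
have Wr : 2 ^ r <= 2 ^ (r * N) * 2 ^ N.
  apply: leq_trans (_ : 2 ^ (r * N) <= _); last by rewrite leq_pmulr // expn_gt0.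
  by rewrite leq_exp2l // leq_pmulr //; lia.
have W_large : 2 ^ r + 40 + 4 * (S.+1 * #|G|.+1) <= W by lia.
have toks a : a \in w -> 16 + 2 * a <= W by move=> /token_lt; rewrite -/N; lia.
have rows_small ls : known_labels k w ls -> rows r ls <= S.
  move=> /known_labels_size lsw; rewrite /rows leq_exp2l // leq_mul2l.
  by apply/orP; right; lia.
have nnW : #|G| * #|G| <= W by lia.
have [s [t [Pst tn sE]]] := runs_solver n_gt0 W_large hr toks rows_small muK cardG uG nnW
  (erefl _) (fun c (cw : c \in w) => cw).
exists s, t; split; first by [].
  rewrite /accepting sE (deletion_lcost r b isoG).
  case: (b) => a /=.
    by split=> [?|[_ ?]]; [split=> //|]; lia.
  by split=> [|[]].
(* [W] has [r * N + N + 7] binary digits; the constant 57 that this leaves is at most [57 * N], as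
   [N] is positive. *)
have bitW : unit_cost W <= (8 * r + 65) * N.
  by rewrite /unit_cost /bitlen trunc_expnK // mulnDl -mulnA; lia.
have SkP : S <= (2 ^ r) ^ k by rewrite -expnM leq_exp2l // leq_mul2l geq_minl orbT.
have SN_gt0 : 0 < S * N by rewrite muln_gt0 S_gt0; lia.
have r1 X : X <= r.+1 * X by rewrite leq_pmull.
(* The 411 is twice the 200 of [node_cost], because [(S * #|G|).+1] is at most [2 * (S * N)], plus
   11 for dispatch. *)
have nodeP : node_cost #|G| S r + 11 <= 411 * (r.+1 * (S * N)).
  have Sn : (S * #|G|).+1 <= 2 * (S * N) by have := leq_mul (leqnn S) nN; lia.
  have := leq_mul (leqnn r.+1) Sn; rewrite mulnCA /node_cost.
  by have := r1 (S * N); lia.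
have steps : #|G| * #|G| * 4 + size (encode_cexpr mu) * (node_cost #|G| S r + 11) + 30
    <= 1000 * (r.+1 * (S * N) * N).
  have : size (encode_cexpr mu) * (node_cost #|G| S r + 11) <=
      N * (411 * (r.+1 * (S * N))) by apply: leq_mul => //; lia.
  rewrite mulnCA [N * _]mulnC.
  have : N <= r.+1 * (S * N) * N.
    by rewrite leq_pmull // muln_gt0.
  by lia.
apply: leq_trans tn (leq_trans (leq_mul steps bitW) _).
have -> : 1000 * (r.+1 * (S * N) * N) * ((8 * r + 65) * N) =
    1000 * r.+1 * (8 * r + 65) * N ^ 3 * S.
  by rewrite !expnS expn0; lia.
by rewrite leq_mul2l SkP orbT.
Qed.
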